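(* Let $(R,\Lambda)$ be a Noetherian algebra such that $\Lambda_{\mathfrak p}$ is Morita equivalent to a local ring for each $\mathfrak p\in\operatorname{Spec}R$. Then: (a) $\mathsf{tors}\,\Lambda=\mathsf{serre}\,\Lambda$ holds, and there is a canonical isomorphism of posets $\mathsf{tors}\,\Lambda\simeq\mathsf{P}_{\rm spcl}(\operatorname{Spec}R)$. (b) There is a canonical isomorphism of posets $\mathsf{torf}\,\Lambda\simeq\mathsf{P}(\operatorname{Spec}R)$. Here both canonical isomorphisms are given by $\mathcal C\mapsto\{\mathfrak p\in\operatorname{Spec}R\mid \mathcal C_{\mathfrak p}\cap\mathsf{fl}\,\Lambda_{\mathfrak p}\neq0\}$.
   Context: A Noetherian algebra $(R,\Lambda)$ is a commutative Noetherian ring $R$ with a (not necessarily commutative) $R$-algebra $\Lambda$ that is finitely generated as an $R$-module. $\Lambda_{\mathfrak p}:=R_{\mathfrak p}\otimes_R\Lambda$. A local ring is nonzero. $\mathsf{mod}$ and $\mathsf{fl}$ denote the categories of finitely generated, respectively finite length, left modules. Subcategories are full and closed under isomorphisms. $\mathsf{tors}\,\Lambda$, $\mathsf{torf}\,\Lambda$, $\mathsf{serre}\,\Lambda$ are the sets of torsion classes (closed under extensions and factor objects), torsionfree classes (closed under extensions and subobjects) and Serre subcategories (closed under extensions, subobjects and factor objects) of $\mathsf{mod}\,\Lambda$, all containing $0$, ordered by inclusion. For a subcategory $\mathcal C$ of $\mathsf{mod}\,\Lambda$, $\mathcal C_{\mathfrak p}:=\{X_{\mathfrak p}\mid X\in\mathcal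 C\}$. $\mathsf P(\operatorname{Spec}R)$ is the poset of all subsets of $\operatorname{Spec}R$ ordered by inclusion, and $\mathsf P_{\rm spcl}(\operatorname{Spec}R)$ its subposet of specialization closed subsets, i.e. subsets $\mathcal S$ such that $\mathfrak q\in\mathcal S$ and $\mathfrak p\supseteq\mathfrak q$ imply $\mathfrak p\in\mathcal S$. *)

(* Defs.v *)
From HB Require Import structures.
From mathcomp Require Import all_boot all_order all_algebra.
From mathcomp Require Import ring.
From mathcomp Require Import boolp classical_sets.

Set Implicit Arguments.
Unset Strict Implicit.
Unset Printing Implicit Defensive.

Import GRing.Theory.

Local Open Scope ring_scope.
Local Open Scope classical_set_scope.
Local Open Scope quotient_scope.

(* A subset of a module is a predicate [S : {pred M}]; it is a submodule when
   [submod_closed S]. A left ideal of a ring [B] is a submodule of [B^o]. Rings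
   may be zero ([pzRingType]), as no nontriviality is assumed of [R] and [L]. *)

Section Modules.
Variable A : pzRingType.

Definition iso_mod (M N : lmodType A) : Prop :=
  exists f : {linear M -> N}, bijective f.

Definition zero_mod (M : lmodType A) : Prop := forall x : M, x = 0.

Definition fg_submod (M : lmodType A) (S : {pred M}) : Prop :=
  exists n (e : 'I_n -> M), (forall i, e i \in S) /\
    forall x, x \in S -> exists c : 'I_n -> A, x = \sum_(i < n) c i *: e i.

Definition fin_gen (M : lmodType A) : Prop := fg_submod (predT : {pred M}).

(* [S] is maximal among the submodules strictly contained in [K]. *)
Definition submod_cover (M : lmodType A) (S K : {pred M}) : Prop :=
  [/\ {subset S <= K}, ~ {subset K <= S} &
      forall T : {pred M}, submod_closed T ->
        {subset S <= T} -> {subset T <= K} -> T =i S \/ T =i K].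

(* [M] has a composition series [S 0 = 0, ..., S n = M]. *)
Definition fin_length (M : lmodType A) : Prop :=
  exists n (S : nat -> {pred M}),
    [/\ forall i, submod_closed (S i), S 0%N =i pred1 0, S n =i predT &
        forall i, (i < n)%N -> submod_cover (S i) (S i.+1)].

Definition maximal_submod (M : lmodType A) (S : {pred M}) : Prop :=
  submod_closed S /\ submod_cover S predT.

Definition short_exact (X Y Z : lmodType A)
    (f : {linear X -> Y}) (g : {linear Y -> Z}) : Prop :=
  [/\ injective f, (forall z, exists y, g y = z) &
      forall y, g y = 0 <-> exists x, f x = y].

End Modules.

Definition local_ring (B : pzRingType) : Prop :=
  (1 : B) <> 0 /\
  exists2 m : {pred B^o}, maximal_submod m &
    forall m' : {pred B^o}, maximal_submod m' -> m' =i m.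

(* Functors between the categories of all left modules. *)
Record mod_functor (A B : pzRingType) := ModFunctor {
  fobj :> lmodType A -> lmodType B;
  fmap : forall M N : lmodType A, {linear M -> N} -> {linear fobj M -> fobj N};
  fmap_id : forall M : lmodType A, fmap (idfun : {linear M -> M}) = idfun;
  fmap_comp : forall (M N P : lmodType A)
      (g : {linear N -> P}) (f : {linear M -> N}),
    fmap (g \o f : {linear M -> P}) = (fmap g \o fmap f : {linear fobj M -> fobj P})
}.

Definition morita_equivalent (A B : pzRingType) : Prop :=
  exists (F : mod_functor A B) (G : mod_functor B A)
         (eta : forall M : lmodType A, {linear M -> G (F M)})
         (eps : forall N : lmodType B, {linear F (G N) -> N}),
    [/\ forall M, bijective (eta M),
        forall N, bijective (eps N),
        forall (M M' : lmodType A) (f : {linear M -> M'}) x,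
          eta M' (f x) = fmap G (fmap F f) (eta M x) &
        forall (N N' : lmodType B) (g : {linear N -> N'}) y,
          eps N' (fmap F (fmap G g) y) = g (eps N y)].

(* [algType R] is restricted to nonzero rings, hence this presentation of an
   algebra by a ring morphism with central image. *)
Record ralgebra (R : comPzRingType) := RAlgebra {
  alg_ring :> pzRingType;
  alg_map : {rmorphism R -> alg_ring};
  alg_mapC : forall r x, alg_map r * x = x * alg_map r
}.

Definition restrict (R A : pzRingType) (f : {rmorphism R -> A})
  (M : lmodType A) : Type := M.

Section Restrict.
Variables (R A : pzRingType) (f : {rmorphism R -> A}) (M : lmodType A).
Local Notation rM := (restrict f M).
HB.instance Definition _ := GRing.Zmodule.on rM.
Let rscale (r : R) (x : rM) : rM := f r *: (x : M).
Let rscaleA r s x : rscale r (rscale s x) = rscale (r * s) x.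
Proof. by rewrite /rscale scalerA rmorphM. Qed.
Let rscale1 : left_id 1 rscale.
Proof. by move=> x; rewrite /rscale rmorph1 scale1r. Qed.
Let rscaleDr : right_distributive rscale +%R.
Proof. by move=> r x y; rewrite /rscale scalerDr. Qed.
Let rscaleDl x : {morph rscale^~ x : r s / r + s}.
Proof. by move=> r s; rewrite /rscale rmorphD scalerDl. Qed.
HB.instance Definition _ :=
  GRing.Zmodule_isLmodule.Build R rM rscaleA rscale1 rscaleDr rscaleDl.
Lemma restrict_scaleE (r : R) (x : rM) : r *: x = f r *: (x : M) :> M.
Proof. by []. Qed.
End Restrict.

Definition noetherian_ring (R : comPzRingType) : Prop :=
  forall I : {pred R^o}, submod_closed I -> fg_submod I.

Definition noetherian_algebra (R : comPzRingType) (L : ralgebra R) : Prop :=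
  noetherian_ring R /\ fin_gen (restrict (alg_map L) L^o).

(* Typed [R^o -> bool] rather than [{pred R^o}], which would put [spec R] in a
   universe too large for [set (spec R)]. *)
Record spec (R : comPzRingType) := Spec {
  prime_mem :> R^o -> bool;
  prime_ideal : submod_closed prime_mem;
  prime_proper : 1 \notin prime_mem;
  prime_prime : forall r s : R,
    r * s \in prime_mem -> (r \in prime_mem) || (s \in prime_mem)
}.

Section Denominators.
Variables (R : comPzRingType) (p : spec R).

Definition denom : Type := {s : R | s \notin prime_mem p}.
HB.instance Definition _ := Choice.on denom.
Definition den (s : denom) : R := sval s.

Lemma denP s : den s \notin prime_mem p.
Proof. exact: (proj2_sig s). Qed.

Definition den1 : denom := exist _ 1 (prime_proper p).

Lemma denM_subproof s t : den s * den t \notin prime_mem p.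
Proof.
apply/negP => /prime_prime.
by rewrite (negPf (denP s)) (negPf (denP t)).
Qed.

Definition denM s t : denom := exist _ (den s * den t) (denM_subproof s t).

Lemma denME s t : den (denM s t) = den s * den t.
Proof. by []. Qed.

End Denominators.

Arguments denM {R p} s t : simpl never.

(* Every [L]-module is an [R]-module along [alg_map L]. *)
Section Action.
Variables (R : comPzRingType) (L : ralgebra R).
Implicit Types (X : lmodType L) (r s : R).

Definition act X r (x : X) : X := alg_map L r *: x.

Lemma actA X r s (x : X) : act r (act s x) = act (r * s) x.
Proof. by rewrite /act scalerA rmorphM. Qed.

Lemma act1 X (x : X) : act 1 x = x.
Proof. by rewrite /act rmorph1 scale1r. Qed.

Lemma actD X r (x y : X) : act r (x + y) = act r x + act r y.
Proof. exact: scalerDr. Qed.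

Lemma actN X r (x : X) : act r (- x) = - act r x.
Proof. exact: scalerN. Qed.

Lemma act0 X r : act r (0 : X) = 0.
Proof. exact: scaler0. Qed.

Lemma actZ X r (a : L) (x : X) : act r (a *: x) = a *: act r x.
Proof. by rewrite /act !scalerA alg_mapC. Qed.

Lemma actZl X r (a : L) (x : X) :
  (act r (a : L^o) : L) *: x = act r (a *: x).
Proof. by rewrite /act scalerA. Qed.

Lemma actZZ X r s (a : L) (x : X) :
  act (r * s) (a *: x) = (act r (a : L^o) : L) *: act s x.
Proof. by rewrite -actA actZ /act scalerA. Qed.

Lemma act_congr X k r s r' s' (x y : X) :
  act r x = act s y -> r' = k * r -> s' = k * s -> act r' x = act s' y.
Proof. by move=> xy -> ->; rewrite -!actA xy. Qed.

End Action.

(* [X_p = R_p (x)_R X] is built as the module of fractions [x / s], [s] outside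
   [p]; [loc_mod_tensor] below is the universal property of the tensor product.
   [L_p] is the case [X = L], with [(a / s)(b / t) = ab / st]. *)
Section Localization.
Variables (R : comPzRingType) (L : ralgebra R) (p : spec R).

Section LocModule.
Variable X : lmodType L.
Implicit Types (x y z : X) (s t u : denom p).

Definition loc_rel (a b : X * denom p) : bool :=
  `[< exists u, act (den u * den b.2) a.1 = act (den u * den a.2) b.1 >].

Lemma loc_rel_equiv : equiv_class_of loc_rel.
Proof.
split.
- by move=> a; apply/asboolP; exists (den1 p).
- by move=> a b; apply/asboolP/asboolP => -[u uE]; exists u.
- move=> [y t] [x s] [z w] /asboolP[/= u uE] /asboolP[/= v vE].
  apply/asboolP; exists (denM u (denM v t)) => /=.
  transitivity (act (den v * den w * (den u * den s)) y).
    by apply: (act_congr (k := den v * den w) uE); ring.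
  by apply: (act_congr (k := den u * den s) vE); ring.
Qed.

Canonical loc_rel_canonical := EquivRelPack loc_rel_equiv.

Definition loc_mod : Type := {eq_quot loc_rel}.
HB.instance Definition _ := Choice.on loc_mod.
HB.instance Definition _ := EqQuotient.on loc_mod.

Definition frac x s : loc_mod := \pi_loc_mod (x, s).

Lemma fracP x s y t : frac x s = frac y t <->
  exists u, act (den u * den t) x = act (den u * den s) y.
Proof. by split=> [/eqmodP/asboolP|H] //; exact/eqmodP/asboolP. Qed.

Lemma frac_eq x s y t : act (den t) x = act (den s) y -> frac x s = frac y t.
Proof. by move=> xy; apply/fracP; exists (den1 p); rewrite !mul1r. Qed.

Lemma frac_repr a : frac (repr a).1 (repr a).2 = a.
Proof. by rewrite /frac -surjective_pairing reprK. Qed.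

Lemma frac_ind (P : loc_mod -> Prop) : (forall x s, P (frac x s)) -> forall a, P a.
Proof. by move=> Pf a; rewrite -[a]frac_repr. Qed.


Let zero : loc_mod := frac 0 (den1 p).
Let opp (a : loc_mod) : loc_mod := frac (- (repr a).1) (repr a).2.
Let add (a b : loc_mod) : loc_mod :=
  frac (act (den (repr b).2) (repr a).1 + act (den (repr a).2) (repr b).1)
       (denM (repr a).2 (repr b).2).

Let oppE x s : opp (frac x s) = frac (- x) s.
Proof.
rewrite /opp; case: (repr _) (frac_repr (frac x s)) => x' s' /= /fracP[u uE].
by apply/fracP; exists u; rewrite !actN uE.
Qed.

Let addE x s y t :
  add (frac x s) (frac y t) = frac (act (den t) x + act (den s) y) (denM s t).
Proof.
rewrite /add; case: (repr (frac x s)) (frac_repr (frac x s)) => x' s' /=.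
move=> /fracP[u uE]; case: (repr _) (frac_repr (frac y t)) => y' t' /=.
move=> /fracP[v vE]; apply/fracP; exists (denM u v).
rewrite !actD !actA !denME; congr (_ + _).
  by apply: (act_congr (k := den v * den t * den t') uE); ring.
by apply: (act_congr (k := den u * den s * den s') vE); ring.
Qed.

Let addA : associative add.
Proof.
elim/frac_ind => x s; elim/frac_ind => y t; elim/frac_ind => z u.
rewrite !addE; apply: frac_eq; rewrite !actD !actA !denME addrA.
by congr (act _ _ + act _ _ + act _ _); ring.
Qed.

Let addC : commutative add.
Proof.
elim/frac_ind => x s; elim/frac_ind => y t; rewrite !addE; apply: frac_eq.
by rewrite !actD !actA !denME addrC; congr (act _ _ + act _ _); ring.
Qed.

Let add0 : left_id zero add.
Proof.
elim/frac_ind => x s; rewrite addE; apply: frac_eq.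
by rewrite act0 add0r actA denME; congr (act _ _); rewrite /den1 /=; ring.
Qed.

Let addN : left_inverse zero opp add.
Proof.
elim/frac_ind => x s; rewrite oppE addE; apply: frac_eq.
by rewrite actN addNr !act0.
Qed.

HB.instance Definition _ := GRing.isZmodule.Build loc_mod addA addC add0 addN.

Lemma frac0 : frac 0 (den1 p) = 0. Proof. by []. Qed.

Lemma fracN x s : - frac x s = frac (- x) s. Proof. exact: oppE. Qed.

Lemma fracD x s y t :
  frac x s + frac y t = frac (act (den t) x + act (den s) y) (denM s t).
Proof. exact: addE. Qed.

End LocModule.

Definition loc_ring : Type := loc_mod L^o.
HB.instance Definition _ := GRing.Zmodule.on loc_ring.

Section LocScale.
Variable X : lmodType L.
Implicit Types (a b : loc_ring) (x y : loc_mod X).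

Definition loc_scale a x : loc_mod X :=
  frac (((repr a).1 : L) *: (repr x).1) (denM (repr a).2 (repr x).2).

Lemma loc_scaleE (a : L) s (x : X) t :
  loc_scale (frac (a : L^o) s) (frac x t) = frac (a *: x) (denM s t).
Proof.
rewrite /loc_scale; case: (repr (frac _ s)) (frac_repr (frac (a : L^o) s)) => a' s' /=.
move=> /fracP[u uE]; case: (repr _) (frac_repr (frac x t)) => y' t' /=.
move=> /fracP[v vE]; apply/fracP; exists (denM u v); rewrite !denME.
have -> : den u * den v * (den s * den t) = den u * den s * (den v * den t) by ring.
have -> : den u * den v * (den s' * den t') = den u * den s' * (den v * den t') by ring.
by rewrite !actZZ uE vE.
Qed.

Lemma loc_scaleDr a x y : loc_scale a (x + y) = loc_scale a x + loc_scale a y.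
Proof.
elim/frac_ind: a => a s; elim/frac_ind: x => x t; elim/frac_ind: y => y u.
rewrite [frac x t + _]fracD !loc_scaleE fracD; apply: frac_eq.
rewrite scalerDr !actD -!actZ !actA !denME.
by congr (act _ _ + act _ _); ring.
Qed.

Lemma loc_scaleDl a b x : loc_scale (a + b) x = loc_scale a x + loc_scale b x.
Proof.
elim/frac_ind: a => a s; elim/frac_ind: b => b t; elim/frac_ind: x => x u.
rewrite [frac a s + _]fracD !loc_scaleE fracD; apply: frac_eq.
rewrite scalerDl !actZl !actD !actA !denME.
by congr (act _ _ + act _ _); ring.
Qed.

End LocScale.

Lemma loc_scaleA (X : lmodType L) (a b : loc_ring) (x : loc_mod X) :
  loc_scale a (loc_scale b x) = loc_scale (loc_scale a b : loc_ring) x.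
Proof.
elim/frac_ind: a => a s; elim/frac_ind: b => b t; elim/frac_ind: x => x u.
rewrite [loc_scale (frac b t) _]loc_scaleE [loc_scale _ (frac b t)]loc_scaleE.
by rewrite 2!loc_scaleE scalerA; apply: frac_eq; rewrite !denME mulrA.
Qed.

Let one : loc_ring := frac (1 : L^o) (den1 p).
Let mul (a b : loc_ring) : loc_ring := loc_scale a b.

Let one_scale (X : lmodType L) (x : loc_mod X) : loc_scale one x = x.
Proof.
elim/frac_ind: x => x s; rewrite loc_scaleE; apply: frac_eq.
by rewrite scale1r denME mul1r.
Qed.

Let mulA : associative mul. Proof. exact: loc_scaleA. Qed.
Let mul1 : left_id one mul. Proof. exact: one_scale. Qed.
Let mulr1' : right_id one mul.
Proof.
elim/frac_ind => a s; rewrite /mul loc_scaleE; apply: frac_eq.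
by rewrite denME mulr1 /GRing.scale /= mulr1.
Qed.
Let mulDl : left_distributive mul +%R.
Proof. by move=> a b c; exact: loc_scaleDl. Qed.
Let mulDr : right_distributive mul +%R.
Proof. by move=> a b c; exact: loc_scaleDr. Qed.

HB.instance Definition _ :=
  GRing.Zmodule_isPzRing.Build loc_ring mulA mul1 mulr1' mulDl mulDr.

HB.instance Definition _ (X : lmodType L) :=
  GRing.Zmodule_isLmodule.Build loc_ring (loc_mod X)
    (@loc_scaleA X) (@one_scale X) (@loc_scaleDr X)
    (fun x a b => loc_scaleDl a b x).

Lemma fracM (a b : L) s t :
  (frac (a : L^o) s : loc_ring) * frac (b : L^o) t = frac (a * b : L^o) (denM s t).
Proof. exact: (loc_scaleE a s (b : L^o) t). Qed.

Lemma fracZ (X : lmodType L) (a : L) s (x : X) t :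
  (frac (a : L^o) s : loc_ring) *: frac x t = frac (a *: x) (denM s t).
Proof. exact: loc_scaleE. Qed.

End Localization.

Section Tensor.
Variables (R : comPzRingType) (p : spec R).

Definition self_algebra : ralgebra R :=
  @RAlgebra R R (idfun : {rmorphism R -> R}) (@mulrC R).

Local Notation Rp := (loc_ring self_algebra p).
Let ratio (r : R) (s : denom p) : Rp := frac (r : R^o : lmodType self_algebra) s.

Lemma loc_mod_tensor (L : ralgebra R) (X : lmodType L) (Z : zmodType)
    (b : Rp -> X -> Z) :
  (forall x, {morph b^~ x : q q' / q + q'}) ->
  (forall q, {morph b q : x y / x + y}) ->
  (forall r q x, b (ratio r (den1 p) * q) x = b q (act r x)) ->
  exists! g : loc_mod p X -> Z,
    {morph g : u v / u + v} /\
    forall r s x, g (frac (act r x) s) = b (ratio r s) x.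
Proof.
move=> bDl bDr bR.
have ratioM r s r' s' : ratio r s * ratio r' s' = ratio (r * r') (denM s s').
  exact: fracM.
have bE r s x : b (ratio r s) x = b (ratio 1 s) (act r x).
  rewrite -bR ratioM mulr1; congr b; apply: frac_eq.
  by rewrite denME mul1r.
have bden x s t : b (ratio 1 s) x = b (ratio 1 (denM s t)) (act (den t) x).
  rewrite -bR ratioM mulr1; congr b; apply: frac_eq.
  rewrite !denME mul1r /act /= /GRing.scale /= mulr1.
  by rewrite mulrC.
pose g (u : loc_mod p X) := b (ratio 1 (repr u).2) (repr u).1.
have gE x s : g (frac x s) = b (ratio 1 s) x.
  rewrite /g; case: (repr _) (frac_repr (frac x s)) => y t /= /fracP[u uE].
  rewrite (bden y t (denM u s)) (bden x s (denM u t)) !denME uE; congr b.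
  apply: frac_eq; rewrite !denME /act /= /GRing.scale /=; ring.
exists g; split.
  split=> [|r s x]; last by rewrite gE [RHS]bE.
  elim/frac_ind => x s; elim/frac_ind => y t; rewrite fracD !gE bDr.
  rewrite (bden x s t) (bden y t s); congr (_ + b _ _).
  by apply: frac_eq; rewrite !denME [den s * _]mulrC.
move=> h [_ hE]; apply/funext; elim/frac_ind => x s.
by rewrite gE -hE act1.
Qed.

End Tensor.

Definition morita_local (A : pzRingType) : Prop :=
  exists2 B : pzRingType, local_ring B & morita_equivalent A B.

(* A full subcategory is the predicate of its objects. The library's [set T]
   cannot be used here: its universe is constrained to be too small for
   [T := lmodType A]. *)
Definition subcat (A : pzRingType) : Type := lmodType A -> Prop.

Section Subcategories.
Variable A : pzRingType.
Implicit Type C : subcat A.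

Definition subcat_le C D : Prop := forall X, C X -> D X.

(* Full, isomorphism-closed subcategories of [mod A] containing [0]. *)
Definition mod_subcat C : Prop :=
  [/\ forall X, C X -> fin_gen X,
      forall X Y, iso_mod X Y -> C X -> C Y &
      forall X, zero_mod X -> C X].

Definition ext_closed C : Prop :=
  forall (X Y Z : lmodType A) (f : {linear X -> Y}) (g : {linear Y -> Z}),
    fin_gen Y -> short_exact f g -> C X -> C Z -> C Y.

Definition sub_closed C : Prop :=
  forall (X Y : lmodType A) (f : {linear X -> Y}),
    fin_gen X -> injective f -> C Y -> C X.

Definition quot_closed C : Prop :=
  forall (X Y : lmodType A) (f : {linear X -> Y}),
    fin_gen Y -> (forall y, exists x, f x = y) -> C X -> C Y.

Definition tors C : Prop := [/\ mod_subcat C, ext_closed C & quot_closed C].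

Definition torf C : Prop := [/\ mod_subcat C, ext_closed C & sub_closed C].

Definition serre C : Prop :=
  [/\ mod_subcat C, ext_closed C, sub_closed C & quot_closed C].

End Subcategories.

Section Support.
Variables (R : comPzRingType) (L : ralgebra R).

Definition loc_subcat (p : spec R) (C : subcat L) : subcat (loc_ring L p) :=
  fun Y => exists2 X, C X & iso_mod (loc_mod p X) Y.

Definition fl_support (C : subcat L) : set (spec R) :=
  [set p | exists Y : lmodType (loc_ring L p),
             [/\ loc_subcat C Y, fin_length Y & ~ zero_mod Y]].

End Support.

Definition spcl_closed (R : comPzRingType) (S : set (spec R)) : Prop :=
  forall q p : spec R, S q -> {subset prime_mem q <= prime_mem p} -> S p.

(* [f] restricts to an isomorphism from the poset of the [x] satisfying [P],
   ordered by [leT], to the poset of the [y] satisfying [Q], ordered by [leU]. *)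
Definition poset_iso (T U : Type) (leT : T -> T -> Prop) (leU : U -> U -> Prop)
    (P : T -> Prop) (Q : U -> Prop) (f : T -> U) : Prop :=
  [/\ forall x, P x -> Q (f x),
      forall x y, P x -> P y -> f x = f y -> x = y,
      forall y, Q y -> exists2 x, P x & f x = y &
      forall x y, P x -> P y -> (leT x y <-> leU (f x) (f y))].

(* Main.v *)
Require Import Defs.
From HB Require Import structures.
From mathcomp Require Import all_boot all_order all_algebra.
From mathcomp Require Import ring.
From mathcomp Require Import boolp classical_sets.
(* [all_algebra] hides [Defs.frac]. *)
Import Defs.

Set Implicit Arguments.
Unset Strict Implicit.
Unset Printing Implicit Defensive.

Import GRing.Theory.

Local Open Scope ring_scope.
Local Open Scope quotient_scope.

(* Call a [L]-module [W] critical at [p] when it is nonzero, killed by [p],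
   torsion-free over [R/p], and all its proper quotients are [R/p]-torsion; then
   [W_p] is a simple [L_p]-module. A ring Morita equivalent to a local ring has
   only one simple module up to isomorphism, so, clearing denominators, any two
   finitely generated modules critical at [p] embed in each other.

   A finitely generated [X] with [X_p <> 0] has a quotient critical at [p] (a
   maximal proper saturated submodule is the kernel), and a nonzero [X] has a
   critical submodule for some [p] (a submodule of minimal rank in [L x], where
   the annihilator [p] of [x] is maximal). Both for torsion and for torsionfree
   [C], the [p] in [fl_support C] are those at which [C] has a critical module.

   For [C] torsion, [Y] is in [C] iff [Y_p <> 0] implies [p] in [fl_support C]:
   take [N] maximal among the submodules of [Y] in [C]; if [N <> Y], then [Y/N]
   has a submodule [V] critical at some [p], and a critical quotient at [p] of a
   module in [C] embeds in [V], hence an extension of it by [N] lies in [Y].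

   For [C] torsionfree, [Y] is in [C] iff the critical submodules of [Y] are
   only at [p] in [fl_support C]: take [N] maximal among the submodules in [C]
   for which [Y/N] has the same property; if [N <> Y], a maximal critical
   submodule [V] of [Y/N] is in [C], and [(Y/N)/V] still has the property, so
   that the preimage of [V] contradicts maximality. *)

(** * Submodules and quotient modules *)

(** [Prop]-valued, so that submodules given by existential formulas need no reflection;
    [submod_pred] and [pred_submod] translate to and from [submod_closed]. *)
Definition submod (A : pzRingType) (M : lmodType A) (S : M -> Prop) : Prop :=
  S 0 /\ forall a x y, S x -> S y -> S (a *: x + y).

Section Submod.
Variables (A : pzRingType) (M : lmodType A).
Implicit Types S T : M -> Prop.

Lemma submod0 S : submod S -> S 0. Proof. by case. Qed.

Lemma submodD S x y : submod S -> S x -> S y -> S (x + y).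
Proof. by move=> [_ SS] Sx Sy; have := SS 1 _ _ Sx Sy; rewrite scale1r. Qed.

Lemma submodZ S a x : submod S -> S x -> S (a *: x).
Proof. by move=> [S0 SS] Sx; have := SS a _ _ Sx S0; rewrite addr0. Qed.

Lemma submodN S x : submod S -> S x -> S (- x).
Proof. by move=> hS Sx; rewrite -scaleN1r; apply: submodZ. Qed.

Lemma submodB S x y : submod S -> S x -> S y -> S (x - y).
Proof. by move=> hS Sx Sy; apply: submodD => //; apply: submodN. Qed.

Lemma submod_sum S n (F : 'I_n -> M) :
  submod S -> (forall i, S (F i)) -> S (\sum_(i < n) F i).
Proof.
by move=> hS SF; apply: big_ind => // [|x y]; [exact: submod0|exact: submodD].
Qed.

Lemma submod_pred S : submod S -> submod_closed [pred x | `[< S x >]].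
Proof.
move=> [S0 SS]; split; first exact/asboolP.
by move=> a x y /asboolP Sx /asboolP Sy; apply/asboolP; apply: SS.
Qed.

Lemma pred_submod (S : {pred M}) : submod_closed S -> submod (fun x => x \in S).
Proof. by case. Qed.

Lemma submod_zero : submod (fun x : M => x = 0).
Proof. by split=> // a x y -> ->; rewrite scaler0 addr0. Qed.

Lemma submod_full : submod (fun _ : M => True).
Proof. by []. Qed.

Lemma submodI S T : submod S -> submod T -> submod (fun x => S x /\ T x).
Proof. by move=> [S0 SS] [T0 TT]; split=> // a x y [? ?] [? ?]; split; auto. Qed.

End Submod.

Lemma submod_preim (A : pzRingType) (M N : lmodType A) (f : {linear M -> N})
  (S : N -> Prop) : submod S -> submod (fun x => S (f x)).
Proof.
move=> [S0 SS]; split; first by rewrite linear0.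
by move=> a x y Sx Sy; rewrite linearP; apply: SS.
Qed.

Lemma submod_im (A : pzRingType) (M N : lmodType A) (f : {linear M -> N})
  (S : M -> Prop) : submod S -> submod (fun y => exists2 x, S x & f x = y).
Proof.
move=> [S0 SS]; split; first by exists 0; rewrite ?linear0.
move=> a _ _ [x Sx <-] [y Sy <-]; exists (a *: x + y); first exact: SS.
by rewrite linearP.
Qed.

Lemma mk_linear (A : pzRingType) (M N : lmodType A) (f : M -> N) :
  (forall a x y, f (a *: x + y) = a *: f x + f y) ->
  exists g : {linear M -> N}, g =1 f.
Proof.
move=> h; pose m := GRing.isLinear.Build A M N *:%R f h.
by pose g : {linear M -> N} := HB.pack f m; exists g.
Qed.


(** The proof [hS] is a parameter so that the module structure, which depends on it, can be inferred
    from the type. *)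
Definition sub_type (A : pzRingType) (M : lmodType A) (S : M -> Prop)
  (hS : submod S) : Type := {x : M | `[< S x >]}.

Section SubModule.
Variables (A : pzRingType) (M : lmodType A) (S : M -> Prop) (hS : submod S).
HB.instance Definition _ := [isSub of sub_type hS for @sval M _].
HB.instance Definition _ := [Choice of sub_type hS by <:].
HB.instance Definition _ :=
  GRing.SubChoice_isSubLmodule.Build A M _ (sub_type hS)
    (GRing.submod_closed_semi (submod_pred hS)).

(** Later proofs see a submodule only as an injection with image [S], never as a subtype. *)
Lemma sub_exists : exists (N : lmodType A) (i : {linear N -> M}),
  injective i /\ forall x, S x <-> exists y, i y = x.
Proof.
have [i iE] := mk_linear
  (fun a (x y : sub_type hS) => linearP (val : {linear sub_type hS -> M}) a x y).
exists (sub_type hS), i; split=> [x y|x]; first by rewrite !iE => /val_inj.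
split=> [Sx|[y <-]]; last by rewrite iE; apply/asboolP/(svalP y).
by exists (exist _ x (introT (asboolP _) Sx) : sub_type hS); rewrite iE.
Qed.
End SubModule.

Section QuotModule.
Variables (A : pzRingType) (M : lmodType A) (S : M -> Prop) (hS : submod S).

Definition quot_rel of submod S := fun x y : M => `[< S (x - y) >].

Lemma quot_rel_equiv : equiv_class_of (quot_rel hS).
Proof.
split=> [x|x y|y x z].
- by apply/asboolP; rewrite subrr; apply: submod0.
- by apply/asboolP/asboolP => /(submodN hS); rewrite opprB.
- move=> /asboolP xy /asboolP yz; apply/asboolP.
  by have := submodD hS xy yz; rewrite addrA subrK.
Qed.

Canonical quot_rel_canonical := EquivRelPack quot_rel_equiv.

Definition quot_type : Type := {eq_quot (quot_rel hS)}.
HB.instance Definition _ := Choice.on quot_type.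
HB.instance Definition _ := EqQuotient.on quot_type.

Definition coset (x : M) : quot_type := \pi_quot_type x.

Lemma cosetP x y : coset x = coset y <-> S (x - y).
Proof. by split=> [/eqmodP/asboolP|H] //; apply/eqmodP/asboolP. Qed.

Lemma coset_ind (P : quot_type -> Prop) : (forall x, P (coset x)) -> forall a, P a.
Proof. by move=> Pf a; rewrite -[a]reprK. Qed.

Lemma coset_repr x : S (repr (coset x) - x).
Proof. by apply/cosetP; apply: reprK. Qed.

Definition coset_add (a b : quot_type) := coset (repr a + repr b).
Definition coset_opp (a : quot_type) := coset (- repr a).
Definition coset_scale r (a : quot_type) := coset (r *: repr a).

Lemma coset_addE x y : coset_add (coset x) (coset y) = coset (x + y).
Proof.
apply/cosetP; rewrite opprD addrACA.
by apply: submodD => //; apply: coset_repr.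
Qed.

Lemma coset_oppE x : coset_opp (coset x) = coset (- x).
Proof. by apply/cosetP; rewrite -opprD; apply: submodN => //; apply: coset_repr. Qed.

Lemma coset_scaleE r x : coset_scale r (coset x) = coset (r *: x).
Proof. by apply/cosetP; rewrite -scalerBr; apply: submodZ => //; apply: coset_repr. Qed.

Lemma coset_addA : associative coset_add.
Proof.
elim/coset_ind=> x; elim/coset_ind=> y; elim/coset_ind=> z.
by rewrite !coset_addE addrA.
Qed.

Lemma coset_addC : commutative coset_add.
Proof. by elim/coset_ind=> x; elim/coset_ind=> y; rewrite !coset_addE addrC. Qed.

Lemma coset_add0 : left_id (coset 0) coset_add.
Proof. by elim/coset_ind=> x; rewrite coset_addE add0r. Qed.

Lemma coset_addN : left_inverse (coset 0) coset_opp coset_add.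
Proof. by elim/coset_ind=> x; rewrite coset_oppE coset_addE addNr. Qed.

HB.instance Definition _ :=
  GRing.isZmodule.Build quot_type coset_addA coset_addC coset_add0 coset_addN.

Lemma coset_scaleA a b x : coset_scale a (coset_scale b x) = coset_scale (a * b) x.
Proof. by elim/coset_ind: x => x; rewrite !coset_scaleE scalerA. Qed.

Lemma coset_scale1 : left_id 1 coset_scale.
Proof. by elim/coset_ind=> x; rewrite coset_scaleE scale1r. Qed.

Lemma coset_scaleDr : right_distributive coset_scale +%R.
Proof.
move=> a; elim/coset_ind=> x; elim/coset_ind=> y.
by rewrite [coset x + _]coset_addE !coset_scaleE [RHS]coset_addE scalerDr.
Qed.

Lemma coset_scaleDl x : {morph coset_scale^~ x : a b / a + b}.
Proof.
move=> a b; elim/coset_ind: x => x.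
by rewrite !coset_scaleE [RHS]coset_addE scalerDl.
Qed.

HB.instance Definition _ := GRing.Zmodule_isLmodule.Build A quot_type
  coset_scaleA coset_scale1 coset_scaleDr coset_scaleDl.

Lemma quot_exists : exists (Q : lmodType A) (f : {linear M -> Q}),
  (forall z, exists x, f x = z) /\ forall x, f x = 0 <-> S x.
Proof.
have [|f fE] := @mk_linear A M quot_type coset.
  move=> a x y; rewrite -[RHS]/(coset_add (coset_scale a _) _).
  by rewrite coset_scaleE coset_addE.
exists quot_type, f; split; first by elim/coset_ind=> x; exists x.
by move=> x; rewrite fE -[S x]/(S x) -[x in S x]subr0; apply: cosetP.
Qed.

End QuotModule.

(** [s] is any section of [f]; the kernel condition makes [g \o s] independent of its choice, hence
    linear. *)
Lemma factor_surj (A : pzRingType) (M N P : lmodType A)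
  (f : {linear M -> N}) (g : {linear M -> P}) :
  (forall z, exists x, f x = z) -> (forall x, f x = 0 -> g x = 0) ->
  exists h : {linear N -> P}, forall x, h (f x) = g x.
Proof.
move=> fs fg; have [s sK] := choice fs.
have gs x : g (s (f x)) = g x.
  by apply/eqP; rewrite -subr_eq0 -linearB fg // linearB /= sK subrr.
have [|h hE] := @mk_linear A N P (g \o s).
  move=> a x y /=; rewrite -linearP -[RHS]gs; congr (g (s _)).
  by rewrite linearP /= !sK.
by exists h => x; rewrite hE /= gs.
Qed.

Lemma factor_inj (A : pzRingType) (M N P : lmodType A)
  (f : {linear N -> M}) (g : {linear P -> M}) :
  injective f -> (forall x, exists y, f y = g x) ->
  exists h : {linear P -> N}, forall x, f (h x) = g x.
Proof.
move=> fi fg; have [h hE] := choice fg.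
have [|k kE] := @mk_linear A P N h.
  by move=> a x y; apply: fi; rewrite linearP /= !hE linearP.
by exists k => x; rewrite kE hE.
Qed.

Lemma linear_injP (A : pzRingType) (M N : lmodType A) (f : {linear M -> N}) :
  (forall x, f x = 0 -> x = 0) -> injective f.
Proof.
move=> f0 x y fxy; apply/eqP; rewrite -subr_eq0; apply/eqP/f0.
by rewrite linearB /= fxy subrr.
Qed.

Lemma linear_bij_inv (A : pzRingType) (M N : lmodType A) (f : {linear M -> N}) :
  bijective f -> exists2 g : {linear N -> M}, cancel f g & cancel g f.
Proof.
case=> g0 fK gK; have [|g gE] := @mk_linear A N M g0.
  by move=> a x y; apply: (can_inj fK); rewrite linearP /= !gK.
by exists g => x; rewrite gE.
Qed.

Lemma bij_of (T U : Type) (f : T -> U) :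
  injective f -> (forall y, exists x, f x = y) -> bijective f.
Proof.
move=> fi fs; have [g gK] := choice fs.
by exists g => // x; apply: fi; rewrite gK.
Qed.

Lemma iso_sym (A : pzRingType) (M N : lmodType A) : iso_mod M N -> iso_mod N M.
Proof.
by case=> f /linear_bij_inv[g fK gK]; exists g; exists f.
Qed.

(** * Noetherian modules *)


(** Finite generation as an induction principle, without coefficients: generators over [R] then
    generate over [L] at once, since [L]-submodules are [R]-submodules. *)
Definition fgs (A : pzRingType) (M : lmodType A) (S : M -> Prop) : Prop :=
  exists s : seq M, (forall x, x \in s -> S x) /\
    forall T, submod T -> (forall x, x \in s -> T x) -> forall x, S x -> T x.

Definition noeth (A : pzRingType) (M : lmodType A) : Prop :=
  forall S : M -> Prop, submod S -> fgs S.

Section Noetherian.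
Variables (A : pzRingType) (M : lmodType A).
Implicit Types S T : M -> Prop.

Lemma fg_submod_fgs (S : {pred M}) : fg_submod S -> fgs (fun x => x \in S).
Proof.
case=> n [e [eS gen]]; exists (codom e); split=> [x /codomP[i ->]|T hT eT x] //.
by case/gen=> c ->; apply: submod_sum => // i; apply: submodZ => //; apply/eT/codom_f.
Qed.

Lemma fgs_fin_gen : fgs (fun _ : M => True) -> fin_gen M.
Proof.
case=> s [_ gen]; exists (size s), (fun i => s`_i); split=> // x _.
pose T x := exists c : 'I_(size s) -> A, x = \sum_(i < size s) c i *: s`_i.
apply: (gen T) => //.
  split; first by exists (fun _ => 0); rewrite big1 // => i _; rewrite scale0r.
  move=> a _ _ [c ->] [d ->]; exists (fun i => a * c i + d i).
  rewrite scaler_sumr -big_split /=; apply: eq_bigr => i _.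
  by rewrite scalerDl scalerA.
move=> y ys; have iy : (index y s < size s)%N by rewrite index_mem.
exists (fun i => if i == Ordinal iy then 1 else 0).
rewrite (bigD1 (Ordinal iy)) //= eqxx scale1r nth_index //.
by rewrite big1 ?addr0 // => i /negPf ->; rewrite scale0r.
Qed.

Lemma fin_genP : fin_gen M <-> fgs (fun _ : M => True).
Proof.
split=> [/fg_submod_fgs[s [_ gen]]|]; last exact: fgs_fin_gen.
by exists s; split=> // T hT sT x _; apply: gen.
Qed.

(** Otherwise [choice] yields a strictly increasing chain; its union is finitely generated, so some
    term contains the generators and with them the next term. *)
Lemma noeth_max (P : (M -> Prop) -> Prop) : noeth M ->
  (exists2 S, submod S & P S) ->
  exists S, [/\ submod S, P S & forall T, submod T -> P T ->
    (forall x, S x -> T x) -> forall x, T x -> S x].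
Proof.
move=> nM [S0 hS0 PS0]; apply: contrapT => no.
pose G := {S : M -> Prop | submod S /\ P S}.
have step (g : G) : exists h : G,
    (forall x, sval g x -> sval h x) /\ exists x, sval h x /\ ~ sval g x.
  case: g => S [hS PS] /=; apply: contrapT => nx; apply: no.
  exists S; split=> // T hT PT ST x Tx; apply: contrapT => nSx; apply: nx.
  by exists (exist _ T (conj hT PT)); split=> //; exists x.
have [f fP] := choice step.
pose ch n := sval (iter n f (exist _ S0 (conj hS0 PS0) : G)).
have chS n : submod (ch n) by rewrite /ch; case: (iter _ _ _) => S [].
have chm n m x : (n <= m)%N -> ch n x -> ch m x.
  move=> /subnK <-; elim: (m - n)%N => // k IH cx.
  by rewrite addSn; apply: (fP _).1; apply: IH.
have hU : submod (fun x => exists n, ch n x).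
  split; first by exists 0%N; apply: submod0.
  move=> a x y [n nx] [m my]; exists (maxn n m).
  apply: submodD => //; first apply: submodZ => //.
    by apply: chm nx; apply: leq_maxl.
  by apply: chm my; apply: leq_maxr.
have [s [sU gen]] := nM _ hU.
have [N sN] : exists N, forall x, x \in s -> ch N x.
  elim: s sU {gen} => [|a s IH] sU; first by exists 0%N.
  have [N sN] := IH (fun x xs => sU x (mem_behead (s := a :: s) xs)).
  have [m ma] := sU a (mem_head _ _).
  exists (maxn N m) => x; rewrite inE => /orP[/eqP -> | xs].
    by apply: chm ma; apply: leq_maxr.
  by apply: chm (sN _ xs); apply: leq_maxl.
have [x [x1 x2]] := (fP (iter N f (exist _ S0 (conj hS0 PS0) : G))).2.
by apply: x2; apply: (gen (ch N)) => //; exists N.+1.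
Qed.

Lemma noeth_fg : noeth M -> fin_gen M.
Proof. by move=> nM; apply/fin_genP/nM. Qed.

Fixpoint lspan (s : seq M) (x : M) : Prop :=
  if s is a :: s' then exists r, lspan s' (x - r *: a) else x = 0.

Lemma submod_lspan s : submod (lspan s).
Proof.
elim: s => [|a s IH]; first exact: submod_zero.
split.
  by exists 0; rewrite scale0r subr0; apply: (submod0 IH).
move=> r x y [b hb] [c hc].
exists (r * b + c); have := IH.2 r _ _ hb hc.
by rewrite scalerBr scalerDl scalerA addrACA opprD.
Qed.

Lemma lspan_behead a s x : lspan s x -> lspan (a :: s) x.
Proof. by move=> sx; exists 0; rewrite scale0r subr0. Qed.

Lemma lspan_head a s : lspan (a :: s) a.
Proof. by exists 1; rewrite scale1r subrr; apply: (submod0 (submod_lspan s)). Qed.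

Lemma mem_lspan s x : x \in s -> lspan s x.
Proof.
elim: s => // a s IH; rewrite inE => /orP[/eqP -> | /IH xs].
  exact: lspan_head.
exact: lspan_behead.
Qed.

Lemma lspan_min s T : submod T -> (forall x, x \in s -> T x) ->
  forall x, lspan s x -> T x.
Proof.
move=> hT; elim: s => [|a s IH] sT x /=; first by move=> ->; apply: submod0.
case=> r /(IH (fun y ys => sT y (mem_behead (s := a :: s) ys))) h.
rewrite -[x](subrK (r *: a)); apply: submodD => //; apply: submodZ => //.
exact/sT/mem_head.
Qed.

Lemma fgs_lspan S : fgs S -> exists2 s, (forall x, x \in s -> S x) &
  forall x, S x -> lspan s x.
Proof.
case=> s [sS gen]; exists s => // x Sx.
by apply: gen Sx; [apply: submod_lspan|apply: mem_lspan].
Qed.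

End Noetherian.

Lemma preim_seq (T U : eqType) (f : T -> U) (P : T -> Prop) (s : seq U) :
  (forall y, y \in s -> exists2 x, P x & f x = y) ->
  exists2 t : seq T, (forall x, x \in t -> P x) & map f t = s.
Proof.
elim: s => [|a s IH] h; first by exists [::].
have [t tP <-] := IH (fun y ys => h y (mem_behead (s := a :: s) ys)).
have [x Px <-] := h a (mem_head _ _).
by exists (x :: t) => // y; rewrite inE => /orP[/eqP -> | /tP].
Qed.

(** Induction on the list: for a submodule [S] of the span of [a :: s], the coefficients at [a] form
    a left ideal [I S]; lifts of its generators, with generators of the intersection of [S] and the
    span of [s], generate [S]. *)
Lemma noeth_lspan (A : pzRingType) (M : lmodType A) (s : seq M) (S : M -> Prop) :
  noeth A^o -> submod S -> (forall x, S x -> lspan s x) -> fgs S.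
Proof.
move=> nA; elim: s S => [|a s IH] S hS Ss.
  by exists [::]; split=> // T hT _ x /Ss ->; apply: submod0.
have hs := submod_lspan s.
pose I (T : M -> Prop) (r : A) := exists2 y, lspan s y & T (r *: a + y).
have hI T : submod T -> submod (I T : A^o -> Prop).
  move=> hT; split; first by exists 0; rewrite ?scale0r ?addr0; apply: submod0.
  move=> r b c [y ys yT] [z zs zT]; exists (r *: y + z); first exact: hs.2.
  have -> : (r * (b : A) + (c : A)) *: a + (r *: y + z) =
      r *: ((b : A) *: a + y) + ((c : A) *: a + z); last exact: hT.2.
  by rewrite scalerDl scalerDr scalerA addrACA.
have [rs [rsI genI]] := nA _ (hI _ hS).
have [ms mS mE] : exists2 t : seq (A * M)%type,
    (forall u, u \in t -> lspan s u.2 /\ S (u.1 *: a + u.2)) & map fst t = rs.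
  by apply: preim_seq => r /rsI[y ys yS]; exists (r, y).
have [ss [ssS gens]] := IH _ (submodI hS hs) (fun x H => H.2).
exists ([seq u.1 *: a + u.2 | u <- ms] ++ ss); split=> [x|T hT genT x Sx].
  by rewrite mem_cat => /orP[/mapP[u /mS[_ uS] ->] | /ssS[]].
have hST := submodI hS hT.
have [r ry] := Ss _ Sx.
(* The generation of [I S] is applied to the intersection of [S] and [T], not to [T] alone, so that
   the lift of [r] is in [S] and its difference with [x] is again in [S]. *)
have [y ys [yS yT]] : I (fun x => S x /\ T x) r.
  apply: (genI _ (hI _ hST)).
    move=> b; rewrite -mE => /mapP[u um ->]; have [us uS] := mS _ um.
    exists u.2 => //; split=> //; apply: genT; rewrite mem_cat; apply/orP; left.
    by apply/mapP; exists u.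
  by exists (x - r *: a); rewrite // addrC subrK.
rewrite -[x](subrK (r *: a + y)); apply: submodD => //.
apply: gens => //; first by move=> z zs; apply: genT; rewrite mem_cat zs orbT.
split; first exact: submodB.
by rewrite opprD addrA; apply: submodB.
Qed.

Lemma noeth_inj (A : pzRingType) (X Y : lmodType A) (f : {linear X -> Y}) :
  injective f -> noeth Y -> noeth X.
Proof.
move=> fi nY S hS; have [s [sS gen]] := nY _ (submod_im f hS).
have [t tS tE] := preim_seq sS; exists t; split=> // T hT tT x Sx.
have [] := gen _ (submod_im f hT) _ (f x); last by move=> y Ty /fi <-.
  by move=> y; rewrite -tE => /mapP[z zt ->]; exists z => //; apply: tT.
by exists x.
Qed.

Lemma fin_gen_surj (A : pzRingType) (X Y : lmodType A) (f : {linear X -> Y}) :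
  (forall y, exists x, f x = y) -> fin_gen X -> fin_gen Y.
Proof.
move=> fs /fin_genP[s [_ gen]]; apply/fin_genP.
exists (map f s); split=> // T hT sT y _; have [x <-] := fs y.
by apply: (gen _ (submod_preim f hT)) => // z zs; apply/sT/map_f.
Qed.

Lemma noeth_ringP (R : comPzRingType) : noetherian_ring R -> noeth R^o.
Proof.
move=> nR S hS; have [s [sS gen]] := fg_submod_fgs (nR _ (submod_pred hS)).
exists s; split=> [x /sS /asboolP|T hT sT x Sx] //; apply: (gen T) => //.
exact/asboolP.
Qed.

(** * Finite generation over a Noetherian algebra *)

Section Algebra.
Variables (R : comPzRingType) (L : ralgebra R).
Hypothesis noethL : noetherian_algebra L.
Implicit Type X : lmodType L.
Local Notation res X := (restrict (alg_map L) X).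

Lemma submod_res X (S : X -> Prop) : submod S -> submod (S : res X -> Prop).
Proof. by move=> [S0 SS]; split=> // r x y Sx Sy; apply: SS. Qed.

(** Products of generators of [L] over [R] with generators of [X] over [L] generate: the principle
    for [X] is applied to the [y] all of whose multiples lie in [T], then the one for [L]. *)
Lemma fin_gen_res X : fin_gen X -> fin_gen (res X).
Proof.
move=> /fin_genP[s [_ gen]]; have /fin_genP[t [_ gent]] := noethL.2.
apply/fin_genP; exists [seq a *: (x : X) | a <- (t : seq L), x <- s].
split=> // T hT sT x _; rewrite -[x : X]scale1r.
apply: (gen (fun y : X => forall a : L, T (a *: y))) => //.
  split=> [a|b u v Tu Tv a]; first by rewrite scaler0; exact: hT.1.
  by rewrite scalerDr scalerA; apply: (submodD hT).
move=> y ys a.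
apply: (gent (fun a : res L^o => T ((a : L) *: y))) => //.
  split; first by rewrite scale0r; exact: hT.1.
  move=> r b c Tb Tc; rewrite scalerDl -scalerA.
  by have := hT.2 r _ _ Tb Tc.
by move=> b bt; apply: sT; apply: allpairs_f.
Qed.

Lemma noeth_res X : fin_gen X -> noeth (res X).
Proof.
move=> /fin_gen_res/fin_genP/fgs_lspan[s _ gen] S hS.
by apply: (@noeth_lspan _ _ s) => //; [apply/noeth_ringP/noethL.1|move=> x _; apply: gen].
Qed.

Lemma noeth_mod X : fin_gen X -> noeth X.
Proof.
move=> fX S hS; have [s [sS gen]] := noeth_res fX (submod_res hS).
by exists s; split=> // T hT; apply: gen; apply: submod_res.
Qed.

Lemma fin_gen_inj X (Y : lmodType L) (f : {linear X -> Y}) :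
  injective f -> fin_gen Y -> fin_gen X.
Proof. by move=> fi /noeth_mod nY; apply/noeth_fg/(noeth_inj fi). Qed.

End Algebra.

(** * Simple modules and Morita equivalence *)

Definition simple_mod (A : pzRingType) (M : lmodType A) : Prop :=
  ~ zero_mod M /\ forall T : M -> Prop, submod T ->
    (exists2 x, T x & x <> 0) -> forall x, T x.

Lemma nonzero_mod (A : pzRingType) (M : lmodType A) :
  ~ zero_mod M -> exists x : M, x <> 0.
Proof.
move=> nz; apply: contrapT => no; apply: nz => x; apply: contrapT => x0.
by apply: no; exists x.
Qed.

(* Phrased with the maps out of [M], hence preserved by equivalences. *)
Lemma simple_modP (A : pzRingType) (M : lmodType A) :
  simple_mod M <-> ~ zero_mod M /\ forall (N : lmodType A) (f : {linear M -> N}),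
    injective f \/ forall x, f x = 0.
Proof.
split=> -[nz h]; split=> //.
  move=> N f; case: (pselect (exists2 x, f x = 0 & x <> 0)) => [ker|noker].
    right=> x; apply: (h (fun x => f x = 0)) => //.
    exact: (submod_preim f (submod_zero N)).
  left; apply: linear_injP => x fx; apply: contrapT => x0.
  by apply: noker; exists x.
move=> T hT [x Tx x0] y; have [Q [f [_ kf]]] := quot_exists hT.
case: (h Q f) => [fi|f0]; last exact/kf.
by case: x0; apply: fi; rewrite linear0; apply/kf.
Qed.

(** [fmap] takes bundled maps, so pointwise equality must become equality of bundles; proof
    irrelevance identifies the linearity proofs. *)
Lemma linear_ext (A : pzRingType) (M N : lmodType A) (f g : {linear M -> N}) :
  f =1 g -> f = g.
Proof.
case: f => f [[a] [b]]; case: g => g [[c] [d]] /= fg.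
have {fg} E : f = g by apply: funext.
case: _ / E c d => c d.
by rewrite (Prop_irrelevance c a) (Prop_irrelevance d b).
Qed.

(** * Simple modules over a local ring *)

Section LocalRing.
Variable B : pzRingType.
Hypothesis locB : local_ring B.

(** A left ideal [T] strictly above the annihilator has [T x = S], so each [a] agrees on [x] with
    some [c] in [T], and [a - c] kills [x]. *)
Lemma simple_ann_max (S : lmodType B) (x : S) : simple_mod S -> x <> 0 ->
  maximal_submod ([pred b : B^o | `[< (b : B) *: x = 0 >]] : {pred B^o}).
Proof.
move=> [_ smp] x0; split.
  split; first by apply/asboolP; rewrite scale0r.
  move=> a b c /asboolP bx /asboolP cx; apply/asboolP.
  by rewrite scalerDl -scalerA bx cx scaler0 addr0.
split=> // [h|T hT annT _].
  by have /asboolP := h 1 isT; rewrite scale1r.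
case: (pselect (exists2 b : B, (b : B^o) \in T & b *: x <> 0)) => [[b bT bx]|no].
  right=> a; rewrite inE.
  have [c cT cx] : exists2 c : B, (c : B^o) \in T & c *: x = (a : B) *: x.
    apply: (smp (fun y => exists2 c : B, (c : B^o) \in T & c *: x = y)).
      split; first by exists 0; rewrite ?scale0r //; case: hT.
      move=> r _ _ [c cT <-] [d dT <-]; exists (r * c + d).
        by have := hT.2 r _ _ cT dT.
      by rewrite scalerDl scalerA.
    by exists (b *: x) => //; exists b.
  have : (a - c : B^o) \in T.
    by apply: annT; apply/asboolP; rewrite scalerBl cx subrr.
  move=> acT; have := hT.2 1 _ _ acT cT.
  by rewrite scale1r subrK.
left=> b; apply/idP/idP => [bT|/annT] //.
by apply/asboolP; apply: contrapT => bx; apply: no; exists b.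
Qed.

(** Nonzero [x] and [y] have the same annihilator, the unique maximal left ideal, and both modules
    are the quotient of [B] by it. *)
Lemma local_simple_iso (S S' : lmodType B) :
  simple_mod S -> simple_mod S' -> iso_mod S S'.
Proof.
move=> smpS smpS'; have [_ [m _ mP]] := locB.
have [x x0] := nonzero_mod smpS.1; have [y y0] := nonzero_mod smpS'.1.
have ann b : b *: x = 0 <-> b *: y = 0.
  have E : `[< b *: x = 0 >] = `[< b *: y = 0 >] :=
    etrans (mP _ (simple_ann_max smpS x0) b) (esym (mP _ (simple_ann_max smpS' y0) b)).
  by split=> /asboolP; [rewrite E|rewrite -E] => /asboolP.
have lin (T : lmodType B) (z : T) a (b c : B^o) :
    (a *: b + c : B) *: z = a *: ((b : B) *: z) + (c : B) *: z.
  by rewrite scalerDl scalerA.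
have [f fE] := mk_linear (lin _ x); have [g gE] := mk_linear (lin _ y).
have surj (T : lmodType B) (z : T) : simple_mod T -> z <> 0 ->
    forall w, exists b : B, b *: z = w.
  move=> [_ smp] z0; apply: (smp (fun w => exists b : B, b *: z = w)).
    split; first by exists 0; rewrite scale0r.
    by move=> r _ _ [c <-] [d <-]; exists (r * c + d); rewrite scalerDl scalerA.
  by exists z => //; exists 1; rewrite scale1r.
have [h hE] : exists h : {linear S -> S'}, forall b, h (f b) = g b.
  apply: factor_surj => [z|b].
    by have [b <-] := surj _ _ smpS x0 z; exists b; rewrite fE.
  by rewrite fE gE => /ann.
exists h; apply: bij_of.
  apply: linear_injP => z; have [b <-] := surj _ _ smpS x0 z.
  by have := hE b; rewrite fE gE => -> /ann.
move=> z; have [b <-] := surj _ _ smpS' y0 z.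
by exists (f b); rewrite hE gE.
Qed.

End LocalRing.

(** * Transport of simple modules along an equivalence *)

Section Morita.
Variables (A B : pzRingType) (F : mod_functor A B) (G : mod_functor B A).
Variables (eta : forall M : lmodType A, {linear M -> G (F M)})
          (eps : forall N : lmodType B, {linear F (G N) -> N}).
Hypotheses (eta_bij : forall M, bijective (eta M))
  (eps_bij : forall N, bijective (eps N))
  (eta_nat : forall (M M' : lmodType A) (f : {linear M -> M'}) x,
          eta M' (f x) = fmap G (fmap F f) (eta M x))
  (eps_nat : forall (N N' : lmodType B) (g : {linear N -> N'}) y,
          eps N' (fmap F (fmap G g) y) = g (eps N y)).

Lemma fmapF_inj (M N : lmodType A) (u v : {linear M -> N}) :
  fmap F u =1 fmap F v -> u =1 v.
Proof.
move=> uv x; apply: (bij_inj (eta_bij N)).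
by rewrite !eta_nat (linear_ext uv).
Qed.

Lemma fmapG_inj (M N : lmodType B) (u v : {linear M -> N}) :
  fmap G u =1 fmap G v -> u =1 v.
Proof.
move=> uv x; have [e _ eK] := eps_bij M.
by rewrite -[x]eK -!eps_nat (linear_ext uv).
Qed.

Lemma fmapG_comp (M N P : lmodType B) (g : {linear N -> P}) (f : {linear M -> N}) x :
  fmap G (g \o f : {linear M -> P}) x = fmap G g (fmap G f x).
Proof. by rewrite fmap_comp. Qed.

(** The inclusion of the kernel is compared with the zero map. *)
Lemma linear_mono (C : pzRingType) (M N : lmodType C) (f : {linear M -> N}) :
  (forall (T : lmodType C) (u v : {linear T -> M}),
     (forall x, f (u x) = f (v x)) -> u =1 v) -> injective f.
Proof.
move=> mono; have hk := submod_preim f (submod_zero N).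
have [T [i [ii iE]]] := sub_exists hk.
apply: linear_injP => x /(iE x).1[y <-].
rewrite (mono _ i \0%R) // => z /=; rewrite linear0.
by apply/iE; exists z.
Qed.

(** By [simple_modP] it is enough to study maps [f] out of [F M]: [fmap G f \o eta M] is injective
    or zero, and so is [f], as the faithful [G] reflects both. *)
Lemma simple_mod_fobj (M : lmodType A) : simple_mod M -> simple_mod (F M).
Proof.
move=> /simple_modP[nz smp]; apply/simple_modP; split.
  move=> z; apply: nz => x.
  by apply: (@fmapF_inj M M idfun \0%R) => y; rewrite (z (fmap F _ y)) (z (fmap F \0%R y)).
move=> N f; case: (smp _ (fmap G f \o eta M : {linear M -> G N})) => [fi|f0].
  left; apply: linear_mono => T u v fuv; apply: fmapG_inj => x.
  have Gi : injective (fmap G f).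
    move=> y z; have [e _ eK] := eta_bij M.
    by rewrite -[y]eK -[z]eK => /fi ->.
  apply: Gi; rewrite -!fmapG_comp; congr (fmap G _ x).
  exact: linear_ext.
right=> x; have Gf0 y : fmap G f y = 0.
  by have [e _ eK] := eta_bij M; rewrite -[y]eK; apply: f0.
(* [mod_functor] does not include additivity, so [fmap G] of a zero map is not computed: [fmap G f]
   kills both composites, and faithfulness gives [f x = f 0]. *)
have := @fmapG_inj _ _ (f \o idfun : {linear F M -> N}) (f \o \0%R : {linear F M -> N}).
by move=> -> /=; rewrite ?linear0 // => y; rewrite !fmapG_comp !Gf0.
Qed.

End Morita.

(** [F] carries both modules to simple modules over the local ring, which are isomorphic; [G] and
    [eta] carry the isomorphism back. *)
Lemma morita_local_simple (A : pzRingType) : morita_local A ->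
  forall M N : lmodType A, simple_mod M -> simple_mod N -> iso_mod M N.
Proof.
move=> [B locB [F [G [eta [eps [eta_bij eps_bij eta_nat eps_nat]]]]]] M N sM sN.
have [f /linear_bij_inv[g fK gK]] := local_simple_iso locB
  (simple_mod_fobj eta_bij eps_bij eta_nat eps_nat sM)
  (simple_mod_fobj eta_bij eps_bij eta_nat eps_nat sN).
have [e eK Ke] := linear_bij_inv (eta_bij N).
have [d dK Kd] := linear_bij_inv (eta_bij M).
have fg : fmap G f \o fmap G g =1 id.
  move=> x /=; rewrite -fmapG_comp -[RHS]/((idfun : {linear _ -> _}) x) -fmap_id.
  by congr (fmap G _ x); apply: linear_ext => y /=; rewrite gK.
have gf : fmap G g \o fmap G f =1 id.
  move=> x /=; rewrite -fmapG_comp -[RHS]/((idfun : {linear _ -> _}) x) -fmap_id.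
  by congr (fmap G _ x); apply: linear_ext => y /=; rewrite fK.
exists (e \o (fmap G f \o eta M) : {linear M -> N}).
exists (d \o (fmap G g \o eta N)) => x /=.
  by rewrite Ke; have /= -> := gf (eta M x); rewrite dK.
by rewrite Kd; have /= -> := fg (eta N x); rewrite eK.
Qed.

(** Over a zero ring [A] all modules vanish, so [G] cannot tell the identity of [B^o] from zero, and
    faithfulness gives [1 = 0] in [B]. *)
Lemma morita_local_nonzero (A : pzRingType) : morita_local A -> (1 : A) <> 0.
Proof.
move=> [B [B1 _] [F [G [eta [eps [eta_bij eps_bij eta_nat eps_nat]]]]]] A0.
have z (M : lmodType A) (x : M) : x = 0 by rewrite -[x]scale1r A0 scale0r.
apply: B1; apply: (@fmapG_inj _ _ F G _ eps_bij eps_nat B^o B^o idfun \0%R).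
by move=> x; rewrite [LHS]z [RHS]z.
Qed.

(** * Critical modules *)

Section Fractions.
Variables (R : comPzRingType) (L : ralgebra R) (p : spec R).
Implicit Types (X Y W : lmodType L) (s t u : denom p).

Lemma denP_of (r : R) : r \notin prime_mem p -> exists s, den s = r.
Proof. by move=> rp; exists (exist _ r rp). Qed.

Lemma frac_eq0 X (x : X) s : frac x s = 0 <-> exists u, act (den u) x = 0.
Proof.
rewrite -(frac0 p X); split=> [/fracP[u]|[u ux]].
  by rewrite act0 => ux; exists (denM u (den1 p)); rewrite denME.
by apply/fracP; exists u; rewrite act0 mulr1.
Qed.

Lemma loc_mod_eq0 X : zero_mod (loc_mod p X) <->
  forall x : X, exists s, act (den s) x = 0.
Proof.
split=> [z x|tor a]; first exact/(frac_eq0 x (den1 p))/z.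
by elim/frac_ind: a => x s; apply/frac_eq0.
Qed.

Lemma frac_linear X (a : L) (x y : X) :
  frac (a *: x + y) (den1 p) =
  (frac (a : L^o) (den1 p) : loc_ring L p) *: frac x (den1 p) + frac y (den1 p).
Proof.
rewrite fracZ fracD; apply: frac_eq.
by rewrite !denME /= !mulr1 !act1.
Qed.

Definition scal (r : R) : loc_ring L p := frac (alg_map L r : L^o) (den1 p).

Lemma scalE X r (x : X) s : scal r *: frac x s = frac (act r x) s.
Proof. by rewrite fracZ; apply: frac_eq; rewrite !denME /= mul1r. Qed.

Lemma scalC r (a : loc_ring L p) : scal r * a = a * scal r.
Proof.
elim/frac_ind: a => a s; rewrite !fracM alg_mapC.
by apply: frac_eq; rewrite !denME mulrC.
Qed.

Lemma scalK X (x : X) s : scal (den s) *: frac x s = frac x (den1 p).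
Proof. by rewrite scalE; apply: frac_eq; rewrite act1. Qed.

Lemma frac_den X (x : X) s t :
  frac x t = (frac (1 : L^o) (denM s t) : loc_ring L p) *: frac (act (den s) x) (den1 p).
Proof.
rewrite fracZ scale1r; apply: frac_eq.
by rewrite !denME /= mulr1 actA mulrC.
Qed.

Lemma submod_frac X (T : loc_mod p X -> Prop) :
  submod T -> submod (fun x : X => T (frac x (den1 p))).
Proof.
move=> [T0 TT]; split=> // a x y Tx Ty.
by rewrite frac_linear; apply: TT.
Qed.

Lemma submod_act X (K : X -> Prop) r x : submod K -> K x -> K (act r x).
Proof. by move=> hK; apply: submodZ. Qed.

Lemma linear_act X Y (f : {linear X -> Y}) r x : f (act r x) = act r (f x).
Proof. exact: linearZ. Qed.

Lemma common_den (T : eqType) (P : denom p -> T -> Prop) (l : seq T) :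
  (forall s t k x, P s x -> den t = k * den s -> P t x) ->
  (forall x, x \in l -> exists s, P s x) ->
  exists s, forall x, x \in l -> P s x.
Proof.
move=> mon; elim: l => [|a l IH] h; first by exists (den1 p).
have [s sP] := IH (fun x xl => h x (mem_behead (s := a :: l) xl)).
have [t tP] := h a (mem_head _ _).
exists (denM s t) => x; rewrite inE => /orP[/eqP -> | xl].
  exact: mon tP _.
by apply: mon (sP _ xl) _; rewrite denME mulrC.
Qed.

(** The kernel of the localization map from [X] to [X_p]. *)
Definition torsion X (x : X) : Prop := exists s, act (den s) x = 0.

Lemma torsion_sub X : submod (@torsion X).
Proof.
split; first by exists (den1 p); rewrite act0.
move=> a x y [s sx] [t ty]; exists (denM s t).
rewrite denME actD actZ -[act _ y]actA ty act0 mulrC -[act _ x]actA sx act0.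
by rewrite scaler0 addr0.
Qed.

Definition torsion_free X : Prop := forall x : X, torsion x -> x = 0.

Definition critical X : Prop :=
  [/\ exists x : X, x <> 0,
      forall (r : R) (x : X), r \in prime_mem p -> act r x = 0,
      torsion_free X &
      forall K : X -> Prop, submod K -> (exists2 x, K x & x <> 0) ->
        forall x, exists s, K (act (den s) x)].

(** A nonzero submodule [T] of [X_p] contracts to a nonzero submodule of [X], which contains a
    denominator multiple of every [z]; so [T] contains every fraction. *)
Lemma critical_simple X : critical X -> simple_mod (loc_mod p X).
Proof.
move=> [[x x0] _ tf crit]; split.
  by move=> /loc_mod_eq0/(_ x)/tf.
move=> T hT [t Tt t0].
elim/frac_ind: t Tt t0 => y s Ty y0; elim/frac_ind=> z u.
have [|v zv] := crit _ (submod_frac hT) _ z.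
  exists y; first by rewrite -(scalK y s); apply: submodZ.
  by move=> E; apply: y0; apply/frac_eq0; exists (den1 p); rewrite E act0.
by rewrite (frac_den z v); apply: submodZ.
Qed.

Lemma critical_inj X Y (f : {linear X -> Y}) :
  injective f -> (exists x : X, x <> 0) -> critical Y -> critical X.
Proof.
move=> fi x0 [_ ann tf crit].
have f0 x : f x = 0 -> x = 0 by move=> fx; apply: fi; rewrite linear0.
split=> // [r x rp|x [s sx]|K hK [x Kx nx] y].
- by apply: f0; rewrite linear_act ann.
- by apply/f0/tf; exists s; rewrite -linear_act sx linear0.
have [|s [z Kz fz]] := crit _ (submod_im f hK) _ (f y).
  by exists (f x); [exists x|move/f0].
by exists s; move: fz; rewrite -linear_act => /fi <-.
Qed.

(** * Clearing denominators *)

Hypothesis noethL : noetherian_algebra L.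

Lemma torsion_bound X : fin_gen X ->
  exists s, forall x : X, torsion x -> act (den s) x = 0.
Proof.
move=> /(noeth_mod noethL)/(_ _ (torsion_sub X))[l [lT gen]].
have [|s sl] := @common_den _ (fun s (x : X) => act (den s) x = 0) l _ lT.
  by move=> s t k x sx ->; rewrite -actA sx act0.
exists s => x; apply: (gen (fun x => act (den s) x = 0)) => //.
split; first by rewrite act0.
by move=> a y z; rewrite actD actZ => -> ->; rewrite scaler0 addr0.
Qed.

(** A common denominator [s] on generators of [W] moves the values of [f] into the image of [X]; a
    second one, [c], kills the torsion of [X] and thereby the ambiguity of the lifts. *)
Lemma lift_injection W X (f : {linear loc_mod p W -> loc_mod p X}) :
  fin_gen W -> fin_gen X -> torsion_free W -> injective f ->
  exists g : {linear W -> X}, injective g.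
Proof.
move=> /fin_genP[l [_ gen]] fX tfW fi; have [c cT] := torsion_bound fX.
pose P s (w : W) := exists y : X,
  scal (den s) *: f (frac w (den1 p)) = frac y (den1 p).
have [|w _|s sP] := @common_den _ P l.
- move=> s t k w [y yE] E; exists (act k y).
  rewrite -scalE -yE scalerA; congr (_ *: _).
  by rewrite E /scal fracM rmorphM; apply: frac_eq; rewrite denME mulr1.
- pose a := f (frac w (den1 p)); exists (repr a).2, (repr a).1.
  by have := scalK (repr a).1 (repr a).2; rewrite frac_repr.
have hP : submod (P s).
  split; first by exists 0; rewrite frac0 linear0 scaler0.
  move=> a v w [y yE] [z zE]; exists (a *: y + z).
  by rewrite !frac_linear linearP /= scalerDr scalerA scalC -scalerA yE zE.
have {gen sP hP} hE w : P s w by apply: (gen _ hP sP).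
(* The chosen numerators [y] are linear only up to torsion, which multiplication by [c] removes. *)
have [y yE] := choice hE.
have ker w : torsion (y w) -> w = 0.
  move=> /(frac_eq0 (y w) (den1 p)); rewrite -yE -linearZ scalE /=.
  rewrite -(linear0 f) => /fi /frac_eq0[t].
  by rewrite actA -denME => tw; apply: tfW; exists (denM t s).
have [|g gE] := @mk_linear L W X (fun w => act (den c) (y w)).
  move=> a v w; apply/eqP; rewrite -subr_eq0 -actZ -actD -actN -actD; apply/eqP/cT.
  apply/(frac_eq0 _ (den1 p)).
  have -> (u u' : X) : frac (u - u') (den1 p) = frac u (den1 p) - frac u' (den1 p).
    by rewrite fracN fracD; apply: frac_eq; rewrite denME /= mulr1 !act1.
  rewrite frac_linear -!yE frac_linear linearP /= scalerDr.
  by rewrite !scalerA scalC subrr.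
exists g; apply: linear_injP => w; rewrite gE => yw.
by apply: ker; exists c.
Qed.

End Fractions.

(** * Linear algebra at a prime ideal *)

Section PrimeIdeal.
Variables (R : comPzRingType) (p : spec R).
Local Notation "r \inp" := (r \in prime_mem p) (at level 70).

Lemma prime0 : (0 : R) \inp. Proof. by have [] := prime_ideal p. Qed.

Lemma primeD (r s : R) : r \inp -> s \inp -> r + s \inp.
Proof. by move=> rp sp; have := (prime_ideal p).2 1 _ _ rp sp; rewrite scale1r. Qed.

Lemma primeM (r s : R) : s \inp -> r * s \inp.
Proof. by move=> sp; have := (prime_ideal p).2 r _ _ sp prime0; rewrite addr0. Qed.

Lemma prime_sum n (F : 'I_n -> R) : (forall i, F i \inp) -> \sum_(i < n) F i \inp.
Proof.
move=> Fp; apply: (big_ind (fun x : R => x \inp)) => // [|x y].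
  exact: prime0.
exact: primeD.
Qed.

Lemma primeBden (s : denom p) (r : R) : r \inp -> exists t : denom p, den t = den s - r.
Proof.
move=> rp; apply: (@denP_of _ p (den s - r)); apply/negP => srp.
by have := primeD srp rp; rewrite subrK (negPf (denP s)).
Qed.

Lemma prime_case (r : R) : r \inp \/ exists s : denom p, den s = r.
Proof. by case: (boolP (r \inp)) => [|/denP_of]; [left|right]. Qed.

(* Gaussian elimination over the domain [R/p]. *)
Lemma prime_dependent n (a : 'I_n.+1 -> 'I_n -> R) :
  exists2 c : 'I_n.+1 -> R, exists i, c i \notin prime_mem p &
    forall j, \sum_(i < n.+1) c i * a i j \inp.
Proof.
elim: n a => [|n IH] a.
  exists (fun _ => 1); last by case.
  by exists ord0; apply: prime_proper.
pose ext (i0 : 'I_n.+2) d (c : 'I_n.+1 -> R) i := if unlift i0 i is Some k then c k else d.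
have extE i0 d c j : \sum_(i < n.+2) ext i0 d c i * a i j =
    d * a i0 j + \sum_(k < n.+1) c k * a (lift i0 k) j.
  rewrite (bigD1_ord i0) //= {1}/ext unlift_none; congr (_ + _).
  by apply: eq_bigr => k _; rewrite /ext liftK.
have extk i0 d c k : ext i0 d c (lift i0 k) = c k by rewrite /ext liftK.
case: (pselect (exists i0, a i0 ord_max \notin prime_mem p)) => [[i0 ai0]|no].
  (* With the pivot in row [i0], the last column is cleared by cross-multiplication, as the pivot
     need not be invertible. *)
  pose b k j := a i0 ord_max * a (lift i0 k) (lift ord_max j)
                - a (lift i0 k) ord_max * a i0 (lift ord_max j).
  have [c [k ck] cb] := IH b.
  (* The coefficient of row [i0] is the one that makes the last column cancel. *)
  exists (ext i0 (- \sum_(k < n.+1) c k * a (lift i0 k) ord_max)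
                 (fun k => c k * a i0 ord_max)).
    exists (lift i0 k); rewrite extk; apply/negP => /prime_prime.
    by rewrite (negPf ck) (negPf ai0).
  move=> j; rewrite extE; case: (unliftP ord_max j) => [j' ->|->].
    move: (cb j'); set u := (X in X \inp -> _); set v := (X in _ -> X \inp).
    suff -> : v = u by [].
    rewrite /u /v mulNr mulr_suml -sumrN -big_split /=; apply: eq_bigr => k' _.
    by rewrite /b; ring.
  rewrite mulNr mulr_suml -sumrN -big_split /= big1 ?prime0 // => k' _.
  by rewrite -mulrA [a i0 _ * _]mulrC mulrA addNr.
(* No pivot: the last column lies in [p], so it is dropped, together with row [0], which gets
   coefficient [0]. *)
have [c [k ck] cb] := IH (fun k j => a (lift ord0 k) (lift ord_max j)).
exists (ext ord0 0 c); first by exists (lift ord0 k); rewrite extk.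
move=> j; rewrite extE mul0r add0r; case: (unliftP ord_max j) => [j' ->|->] //.
apply: prime_sum => k'; apply: primeM.
case: (boolP (a (lift ord0 k') ord_max \inp)) => // ak.
by case: no; exists (lift ord0 k').
Qed.

End PrimeIdeal.

Section Saturated.
Variables (R : comPzRingType) (p : spec R) (M : lmodType R).
Implicit Types (K S : M -> Prop) (s t : denom p) (l : seq M).

Definition saturated K := forall s (x : M), K (den s *: x) -> K x.

(* Nakayama's lemma over [R_p]: saturated submodules of [M] stand for submodules
   of [M_p]. *)
Lemma nakayama (r : R) l K : r \in prime_mem p -> submod K -> saturated K ->
  (forall x, x \in l -> exists s y, lspan l y /\ K (den s *: x - r *: y)) ->
  forall x, x \in l -> K x.
Proof.
move=> rp; elim: l K => // a l IH K hK sK gen.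
(* The saturation of [K + R a]; the induction hypothesis for [l] applies to it. *)
pose K' x := exists s b, K (den s *: x - b *: a).
have hK' : submod K'.
  split; first by exists (den1 p), 0; rewrite scaler0 scale0r subr0; apply: submod0.
  move=> c x y [s [b xb]] [t [d yd]]; exists (denM s t), (c * den t * b + den s * d).
  have := submodD hK (submodZ (c * den t) hK xb) (submodZ (den s) hK yd).
  rewrite denME; congr K; rewrite !scalerBr !scalerDr !scalerA !scalerDl opprD addrACA.
  by congr (_ *: _ + _ + _); ring.
have sK' : saturated K'.
  by move=> s x [t [b xb]]; exists (denM t s), b; rewrite denME -scalerA.
have lK' x : x \in l -> K' x.
  (* Modulo [K'] the part of [z] along [a] disappears, leaving a combination of [l]. *)
  apply: IH => // y yl; have [s [z [[b zb] yz]]] := gen y (mem_behead (s := a :: l) yl).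
  exists s, (z - b *: a); split=> //; exists (den1 p), (r * b).
  move: yz; congr K; by rewrite /= scale1r scalerBr scalerA opprB addrCA addrAC subrr add0r.
have Ka : K a.
  have [s [y [[b yb] ay]]] := gen a (mem_head _ _).
  have [t [c yc]] := lspan_min hK' lK' yb.
  (* Eliminating [y] leaves a multiple of [a] in [K] with coefficient [den t * den s] minus an
     element of [p], again a denominator. *)
  have [u uE] := primeBden (denM t s) (primeM (den t * b + c) rp).
  apply: (sK u); rewrite uE denME.
  have := submodD hK (submodZ (den t) hK ay) (submodZ r hK yc).
  congr K; rewrite !scalerBr !scalerA [den t * r]mulrC -!addrA addKr.
  by rewrite -!scaleNr -!scalerDl; congr (_ *: a); ring.
move=> x; rewrite inE => /orP[/eqP -> // | /lK'[s [b xb]]].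
apply: (sK s); rewrite -[_ *: x](subrK (b *: a)).
by apply: submodD => //; apply: submodZ.
Qed.
End Saturated.

(** * Existence of critical modules *)

Section CriticalExistence.
Variables (R : comPzRingType) (L : ralgebra R).
Hypothesis noethL : noetherian_algebra L.
Implicit Types (X Y Z W : lmodType L) (p : spec R).
Local Notation res X := (restrict (alg_map L) X).

Lemma critical_quotient p X : fin_gen X -> ~ zero_mod (loc_mod p X) ->
  exists W (f : {linear X -> W}), (forall w, exists x, f x = w) /\ critical p W.
Proof.
move=> fX nz.
pose P (K : X -> Prop) := (forall (s : denom p) x, K (act (den s) x) -> K x) /\
  exists x, ~ K x.
have [K [hK [sK [x0 nK]] maxK]] : exists K, [/\ submod K, P K &
    forall T, submod T -> P T -> (forall x, K x -> T x) -> forall x, T x -> K x].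
  apply: noeth_max; first exact: (noeth_mod noethL).
  (* The torsion submodule is saturated, and proper because [X_p] is nonzero. *)
  exists (@torsion _ L p X); first exact: torsion_sub.
  split; first by move=> s x [t tx]; exists (denM t s); rewrite denME -actA.
  apply: contrapT => no; apply: nz; apply/loc_mod_eq0 => x.
  by apply: contrapT => tx; apply: no; exists x.
have max T : submod T -> (forall (s : denom p) x, T (act (den s) x) -> T x) ->
    (forall x, K x -> T x) -> (forall x, T x) \/ forall x, T x -> K x.
  move=> hT sT KT; case: (pselect (exists x, ~ T x)) => [nT|nn].
    by right; apply: maxK.
  by left=> x; apply: contrapT => Tx; apply: nn; exists x.
have [W [f [fs fK]]] := quot_exists hK.
exists W, f; split=> //; split.
- by exists (f x0) => /fK.
- move=> r w rp; have [x <-] := fs w; rewrite -linear_act; apply/fK.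
  (* The saturation of [K + r X]. By maximality it is [X], which [nakayama] excludes, or [K], so
     that [r X] lies in [K]. *)
  pose T x := exists (s : denom p) y, K (act (den s) x - act r y).
  have hT : submod T.
    split; first by exists (den1 p), 0; rewrite !act0 subr0; apply: submod0.
    move=> a y z [s [y' ys]] [t [z' zt]]; exists (denM s t).
    exists (a *: act (den t) y' + act (den s) z').
    have := submodD hK (submodZ a hK (submod_act (den t) hK ys))
                       (submod_act (den s) hK zt).
    congr K; rewrite denME !actD !actN !(actZ _ a) !actA opprD addrACA.
    rewrite scalerDr scalerN.
    by congr (_ *: act _ _ - _ *: act _ _ + (act _ _ - act _ _)); ring.
  have sT (s : denom p) y : T (act (den s) y) -> T y.
    by case=> t [z tz]; exists (denM t s), z; rewrite denME -actA.
  have KT y : K y -> T y.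
    by move=> Ky; exists (den1 p), 0; rewrite act0 subr0 act1.
  case: (max T hT sT KT) => [allT|TK]; last first.
    apply: TK; exists (den1 p), x; rewrite act1 subrr; exact: submod0.
  have /fin_genP/fgs_lspan[l _ lX] := fin_gen_res noethL fX.
  exfalso; apply: nK; have hK' := submod_res hK.
  apply: (lspan_min (s := l) hK' _ (lX x0 I)).
  apply: (nakayama rp hK' sK) => z zl.
  have [s [y ys]] := allT z; exists s, y; split=> //; exact: lX.
- move=> w [s]; have [x <-] := fs w.
  by rewrite -linear_act => /fK/sK/fK.
- move=> K' hK' [w Kw w0] v.
  (* The saturation of the preimage of [K']; it exceeds [K], as a preimage of [w] shows, so it is
     all of [X]. *)
  pose T x := exists s : denom p, K' (f (act (den s) x)).
  have hT : submod T.
    split; first by exists (den1 p); rewrite act0 linear0; apply: submod0.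
    move=> a y z [s ys] [t zt]; exists (denM s t).
    have := submodD hK' (submodZ a hK' (submod_act (den t) hK' ys))
                       (submod_act (den s) hK' zt).
    congr K'; rewrite -!linear_act -linearP; congr (f _).
    by rewrite denME actD (actZ _ a) !actA [den t * _]mulrC.
  case: (max T hT) => [s y [t yt]|y Ky|allT|TK].
  + by exists (denM t s); rewrite denME -actA.
  + exists (den1 p); rewrite act1 (fK y).2 //; exact: submod0.
  + by have [x <-] := fs v; have [s] := allT x; rewrite linear_act; exists s.
  + have [x xw] := fs w; case: w0; rewrite -xw; apply/fK/TK.
    by exists (den1 p); rewrite act1 xw.
Qed.

(** * Rank over the domain [R/p] *)

Section Rank.
Variables (p : spec R) (M : lmodType R).
Hypothesis annM : forall (r : R) (x : M), r \in prime_mem p -> r *: x = 0.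

Definition indep m (u : 'I_m -> M) : Prop :=
  forall c : 'I_m -> R, \sum_(i < m) c i *: u i = 0 ->
    forall i, c i \in prime_mem p.

(** Rank at least [m]; the rank is exactly [m] when moreover [has_rank K m.+1] fails. *)
Definition has_rank (K : M -> Prop) m : Prop :=
  exists2 u : 'I_m -> M, forall i, K (u i) & indep u.

Lemma has_rankS K m : has_rank K m.+1 -> has_rank K m.
Proof.
case=> u uK iu; exists (fun i => u (lift ord0 i)) => // c c0 i.
have := iu (fun i => if unlift ord0 i is Some k then c k else 0) _ (lift ord0 i).
rewrite liftK; apply; rewrite big_ord_recl unlift_none scale0r add0r -[RHS]c0.
by apply: eq_bigr => k _; rewrite liftK.
Qed.

Lemma has_rank_le K m n : (m <= n)%N -> has_rank K n -> has_rank K m.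
Proof.
move=> /subnK <-; elim: (n - m)%N => // k IH h.
by apply/IH/has_rankS; rewrite -addSn.
Qed.

(** [prime_dependent], applied to the coordinates of [n.+1] elements, gives a combination with
    coordinates in [p], which vanishes since [p] kills [M]. *)
Lemma rank_bound n (e : 'I_n -> M) K :
  (forall x, exists c : 'I_n -> R, x = \sum_(i < n) c i *: e i) -> ~ has_rank K n.+1.
Proof.
move=> gen [u _ iu]; have [a aE] := choice (fun i => gen (u i)).
have [c [i ci] cp] := prime_dependent p a.
have := iu c _ i; rewrite (negPf ci) => /(_ _)/wrap[] //.
under eq_bigr => k _ do rewrite aE scaler_sumr.
rewrite exchange_big /= big1 // => j _.
by under eq_bigr => k _ do rewrite scalerA; rewrite -scaler_suml annM.
Qed.

Lemma rank_exists n (e : 'I_n -> M) K :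
  (forall x, exists c : 'I_n -> R, x = \sum_(i < n) c i *: e i) ->
  exists m, has_rank K m /\ ~ has_rank K m.+1.
Proof.
move=> gen; apply: contrapT => no; apply: (rank_bound gen).
have : forall m, has_rank K m; last exact.
elim=> [|m IH]; first by exists (fun _ => 0) => [[]|c _ []].
by apply: contrapT => nm; apply: no; exists m.
Qed.

End Rank.

Lemma critical_submodule p X : fin_gen X -> (exists x : X, x <> 0) ->
  (forall (r : R) (x : X), r \in prime_mem p -> act r x = 0) ->
  torsion_free p X ->
  exists W (f : {linear W -> X}), injective f /\ critical p W.
Proof.
move=> fX [x0 nx0] annX tfX.
have [n [e [_ gen]]] := fin_gen_res noethL fX.
have {}gen x : exists c : 'I_n -> R, x = \sum_(i < n) c i *: e i := gen x isT.
(* The ranks of nonzero [L]-submodules; the least one is taken below. *)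
pose good m := `[< exists K : X -> Prop, [/\ submod K, exists2 x, K x & x <> 0,
  has_rank p (K : res X -> Prop) m & ~ has_rank p (K : res X -> Prop) m.+1] >].
have ex : exists m, good m.
  have [m [hm nm]] := @rank_exists p (res X) annX n e (fun _ => True) gen.
  by exists m; apply/asboolP; exists (fun _ => True); split=> //; exists x0.
have [m /asboolP[K [hK K0 hm nm]] minm] := ex_minnP ex.
have [W [f [fi fK]]] := sub_exists hK; exists W, f; split=> //.
have f0 w : f w = 0 -> w = 0 by move=> fw; apply: fi; rewrite linear0.
split.
- have [x /fK[w <-] fw0] := K0.
  by exists w => w0; apply: fw0; rewrite w0 linear0.
- by move=> r w rp; apply: f0; rewrite linear_act annX.
- by move=> w [s sw]; apply/f0/tfX; exists s; rewrite -linear_act sw linear0.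
move=> T hT [v Tv v0] w.
pose K' x := exists2 w, T w & f w = x.
have hK' : submod K' := submod_im f hT.
have K'0 : exists2 x, K' x & x <> 0 by exists (f v); [exists v|move/f0].
have [m' [hm' nm']] := @rank_exists p (res X) annX n e K' gen.
(* By minimality the image of the nonzero submodule [T] still contains [m] independent elements. *)
have mm' : (m <= m')%N by apply: minm; apply/asboolP; exists K'.
have [u uK iu] := has_rank_le mm' hm'.
(* One element more than the rank of [K] allows, hence a relation with a coefficient outside [p]. *)
pose u' := fun i : 'I_m.+1 => if unlift ord0 i is Some k then u k else f w.
have [c c0 [i ci]] : exists2 c : 'I_m.+1 -> R,
    \sum_(i < m.+1) c i *: (u' i : res X) = 0 & exists i, c i \notin prime_mem p.
  apply: contrapT => no; apply: nm; exists u'.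
    move=> i; rewrite /u'; case: unliftP => [k _|_]; last by apply/fK; exists w.
    by have [z _ <-] := uK k; apply/fK; exists z.
  move=> c c0 i; case: (boolP (c i \in _)) => // ci.
  by case: no; exists c => //; exists i.
move: c0; rewrite big_ord_recl {1}/u' unlift_none.
under eq_bigr => k _ do rewrite /u' liftK.
(* If [c ord0] were in [p], its term would vanish and independence of [u] would put all coefficients
   in [p]. So it is a denominator, and it carries [w] into [T]. *)
case: (prime_case p (c ord0)) => [c0p|[s sE]].
  rewrite [c ord0 *: _]annX // add0r => /iu cp.
  case: (unliftP ord0 i) ci => [k ->|->]; last by rewrite c0p.
  by rewrite cp.
move=> /eqP; rewrite addr_eq0 => /eqP E; exists s.
have : K' (act (den s) (f w)).
  have -> : act (den s) (f w) = c ord0 *: (f w : res X) by rewrite sE.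
  rewrite E; apply: (submodN (submod_res hK')); apply: (submod_sum (submod_res hK')) => k.
  exact: (submodZ _ (submod_res hK')).
by rewrite -linear_act => -[z Tz /fi <-].
Qed.

Lemma critical_exists Z : fin_gen Z -> ~ zero_mod Z ->
  exists p W (f : {linear W -> Z}), injective f /\ critical p W.
Proof.
move=> fZ /nonzero_mod[z0 nz0].
pose ann (z : Z) (r : R) := act r z = 0.
have hann z : submod (ann z : R^o -> Prop).
  split=> [|r a b]; rewrite /ann; first by rewrite /act rmorph0 scale0r.
  move=> az bz; rewrite /act rmorphD scalerDl -[X in X + _]/(act (r * (a : R)) z).
  by rewrite -actA az act0 add0r.
have [I [hI [z nz Iz] maxI]] : exists I : R^o -> Prop, [/\ submod I,
    exists2 z, z <> 0 & I = ann z & forall J : R^o -> Prop, submod J ->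
    (exists2 z, z <> 0 & J = ann z) -> (forall r, I r -> J r) -> forall r, J r -> I r].
  apply: (noeth_max (P := fun I : R^o -> Prop => exists2 z, z <> 0 & I = ann z)).
    exact/noeth_ringP/noethL.1.
  by exists (ann z0) => //; exists z0.
(* A nonzero [y] killed by [I] has annihilator exactly [I]. For [y = s z] this makes [I] prime; for
   [y] in [L z] it gives torsion-freeness. *)
have maxz (y : Z) (r : R) :
    y <> 0 -> (forall r : R, I r -> act r y = 0) -> act r y = 0 -> I r.
  by move=> y0 Iy ry; apply: (maxI (ann y)) => //; exists y.
have I1 : (1 : R) \notin (fun r : R^o => `[< I r >]).
  by apply/negP => /asboolP; rewrite Iz /ann act1.
have Ip (r s : R) : r * s \in (fun r : R^o => `[< I r >]) ->
    (r \in (fun r : R^o => `[< I r >])) || (s \in (fun r : R^o => `[< I r >])).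
  move=> /asboolP; rewrite {1}Iz /ann -actA => rsz.
  case: (pselect (I s)) => [Is|nIs]; first by apply/orP; right; apply/asboolP.
  apply/orP; left; apply/asboolP; apply: maxz rsz; first by rewrite Iz in nIs.
  by move=> t; rewrite Iz /ann actA mulrC -actA => ->; rewrite act0.
pose p := @Spec R (fun r => `[< I r >]) (submod_pred hI) I1 Ip.
have hX : submod (fun y : Z => exists a : L, y = a *: z).
  split; first by exists 0; rewrite scale0r.
  by move=> r _ _ [a ->] [b ->]; exists (r * a + b); rewrite scalerDl scalerA.
have [X [i [ii iE]]] := sub_exists hX.
have iann y (r : R) : I r -> act r (i y) = 0.
  have /iE[a ->] : exists y', i y' = i y by exists y.
  by rewrite Iz actZ => ->; rewrite scaler0.
have i0 y : i y = 0 -> y = 0 by move=> iy; apply: ii; rewrite linear0.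
have [||||W [f [fi crit]]] := @critical_submodule p X.
- exact: (fin_gen_inj noethL ii).
- have /iE[x xz] : exists a : L, z = a *: z by exists 1; rewrite scale1r.
  by exists x => x0; apply: nz; rewrite -xz x0 linear0.
- by move=> r x /asboolP Ir; apply: i0; rewrite linear_act iann.
- move=> x [s sx]; apply: contrapT => x0.
  have /asboolP := denP s; apply; apply: (maxz (i x)).
  + by move=> /i0.
  + exact: iann.
  + by rewrite -linear_act sx linear0.
by exists p, W, (i \o f : {linear W -> Z}); split=> // a b /ii/fi.
Qed.

End CriticalExistence.

(** * Classification *)

Lemma simple_fin_length (A : pzRingType) (M : lmodType A) :
  simple_mod M -> fin_length M.
Proof.
move=> [nz smp]; exists 1%N, (fun i => if i is 0 then (pred1 0 : {pred M}) else predT).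
split=> // [[|i]|[|//] _].
- split; first by rewrite inE.
  by move=> a x y; rewrite !inE => /eqP -> /eqP ->; rewrite scaler0 addr0.
- by split.
split=> // [h|T hT _ _].
  by apply: nz => x; apply/eqP/(h x).
case: (pselect (exists2 x, x \in T & x <> 0)) => [Tx|no].
  right=> x; rewrite [RHS]inE; apply: (smp _ (pred_submod hT) Tx).
left=> x; rewrite [RHS]inE; apply/idP/eqP => [Tx|->]; last by case: hT.
by apply: contrapT => x0; apply: no; exists x.
Qed.

(** The first nonzero term of a composition series is simple. *)
Lemma fin_length_simple (A : pzRingType) (M : lmodType A) :
  fin_length M -> ~ zero_mod M ->
  exists (N : lmodType A) (i : {linear N -> M}), injective i /\ simple_mod N.
Proof.
move=> [n [S [hS S0 Sn cov]]] nz.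
have n0 : (0 < n)%N.
  case: n Sn {cov} => // Sn; case: nz => x; apply/eqP.
  by have := Sn x; rewrite S0 !inE.
have [_ S10 smp] := cov _ n0.
have [N [i [ii iE]]] := sub_exists (pred_submod (hS 1%N)).
exists N, i; split=> //; split.
  move=> z; apply: S10 => x /iE[y <-].
  by rewrite (z y) linear0 S0 inE.
move=> T hT [x Tx x0] y.
pose T' := [pred z | `[< exists2 t, T t & i t = z >]].
case: (smp T'); first exact: submod_pred (submod_im i hT).
- move=> z; rewrite S0 inE => /eqP ->; apply/asboolP.
  by exists 0; [apply: submod0|rewrite linear0].
- by move=> z /asboolP[t _ <-]; apply/iE; exists t.
- move=> /(_ (i x)); rewrite S0 inE => E; case: x0; apply: ii; rewrite linear0.
  by apply/eqP; rewrite -[_ == _]/(i x \in pred1 0) -E; apply/asboolP; exists x.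
move=> /(_ (i y)); have -> : i y \in S 1%N by apply/iE; exists y.
by move=> /asboolP[t Tt /ii <-].
Qed.

Lemma spec_ext (R : comPzRingType) (p q : spec R) :
  (forall r : R, (r \in prime_mem p) = (r \in prime_mem q)) -> p = q.
Proof.
case: p q => [p p1 p2 p3] [q q1 q2 q3] /= pq.
have {pq} E : p = q by apply: funext => r; exact: pq.
case: _ / E q1 q2 q3 => q1 q2 q3.
by rewrite (Prop_irrelevance q1 p1) (Prop_irrelevance q2 p2) (Prop_irrelevance q3 p3).
Qed.

Lemma iso_refl (A : pzRingType) (M : lmodType A) : iso_mod M M.
Proof. by exists idfun; exists id. Qed.

(* The middle term is the preimage under [f] of the image of [h]. *)
Lemma ext_closed_preim (A : pzRingType) (C : subcat A) (X Y Z X' : lmodType A)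
    (i : {linear X -> Y}) (f : {linear Y -> Z}) (h : {linear X' -> Z}) :
  ext_closed C ->
  (forall (E : lmodType A) (k : {linear E -> Y}), injective k -> fin_gen E) ->
  injective i -> (forall z, exists y, f y = z) ->
  (forall y, f y = 0 <-> exists x, i x = y) -> injective h -> C X -> C X' ->
  exists (E : lmodType A) (k : {linear E -> Y}), [/\ C E, injective k &
    forall y, (exists x, f y = h x) <-> exists e, k e = y].
Proof.
move=> extC fgE ii fs fker hi CX CX'.
have hT : submod (fun y => exists x, f y = h x).
  split; first by exists 0; rewrite !linear0.
  by move=> a y z [u yu] [v zv]; exists (a *: u + v); rewrite !linearP yu zv.
have [E [k [ki kE]]] := sub_exists hT.
exists E, k; split=> //.
have [a aE] : exists a : {linear X -> E}, forall x, k (a x) = i x.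
  apply: factor_inj => // x; apply/kE; exists 0; rewrite linear0.
  by apply/fker; exists x.
have [b bE] : exists b : {linear E -> X'}, forall e, h (b e) = (f \o k) e.
  apply: (factor_inj (g := f \o k : {linear E -> Z})) => // e.
  by have /kE[x fx] : exists e', k e' = k e by [exists e]; exists x.
apply: (extC _ _ _ a b) => //; first exact: fgE ki.
split.
- by move=> x y /(congr1 k); rewrite !aE => /ii.
- move=> x; have [y fy] := fs (h x).
  have /kE[e ke] : exists x, f y = h x by exists x.
  by exists e; apply: hi; rewrite bE /= ke.
move=> e; split=> [be|[x <-]].
  have /fker[x ix] : f (k e) = 0 by rewrite -[LHS]bE be linear0.
  by exists x; apply: ki; rewrite aE.
apply: hi; rewrite bE /= aE linear0.
by apply/fker; exists x.
Qed.

Section Classification.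
Variables (R : comPzRingType) (L : ralgebra R).
Hypothesis noethL : noetherian_algebra L.
Implicit Types (X Y Z V W : lmodType L) (p q : spec R) (C D : subcat L).

Lemma loc_nonzero_inj p X Y (f : {linear X -> Y}) : injective f ->
  ~ zero_mod (loc_mod p X) -> ~ zero_mod (loc_mod p Y).
Proof.
move=> fi nz /loc_mod_eq0 z; apply/nz/loc_mod_eq0 => x.
have [s sx] := z (f x); exists s; apply: fi.
by rewrite linear_act sx linear0.
Qed.

Lemma loc_nonzero_surj p X Y (f : {linear X -> Y}) :
  (forall y, exists x, f x = y) ->
  ~ zero_mod (loc_mod p Y) -> ~ zero_mod (loc_mod p X).
Proof.
move=> fs nz /loc_mod_eq0 z; apply/nz/loc_mod_eq0 => y.
have [x <-] := fs y; have [s sx] := z x.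
by exists s; rewrite -linear_act sx linear0.
Qed.

Lemma critical_loc_nonzero p X : critical p X -> ~ zero_mod (loc_mod p X).
Proof. by move=> /critical_simple[]. Qed.

Lemma critical_act_eq0 p X (r : R) (x : X) : critical p X -> x <> 0 ->
  act r x = 0 <-> r \in prime_mem p.
Proof.
move=> [_ ann tf _] x0; split=> [rx|/ann //].
case: (prime_case p r) => // -[s sr].
by case: x0; apply: tf; exists s; rewrite sr.
Qed.

Lemma critical_prime p q X : critical p X -> critical q X -> p = q.
Proof.
move=> cp cq; have [[x x0] _ _ _] := cp; apply: spec_ext => r.
apply/idP/idP => [/(critical_act_eq0 r cp x0)|/(critical_act_eq0 r cq x0)] rx.
  exact/(critical_act_eq0 r cq x0).
exact/(critical_act_eq0 r cp x0).
Qed.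

Definition crit_support C p : Prop := exists2 X, C X & critical p X.

(** Plays the part of the associated primes of [Y]. *)
Definition ass_support Y p : Prop :=
  exists V (i : {linear V -> Y}), injective i /\ critical p V.

Lemma crit_fl_support C p : crit_support C p -> fl_support C p.
Proof.
move=> [X CX cX]; exists (loc_mod p X); split.
- by exists X => //; apply: iso_refl.
- exact/simple_fin_length/critical_simple.
- exact: critical_loc_nonzero.
Qed.

Lemma quot_closed_crit C p X : quot_closed C -> fin_gen X -> C X ->
  ~ zero_mod (loc_mod p X) -> crit_support C p.
Proof.
move=> quoC fX CX nz; have [W [f [fs cW]]] := critical_quotient noethL fX nz.
by exists W => //; apply: (quoC _ _ f) => //; apply: (fin_gen_surj fs).
Qed.

(** A module of [C] with nonzero localization has a quotient critical at [p], again in [C];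
    conversely a critical module localizes to a simple one, which has finite length. *)
Lemma tors_supportP C p : tors C -> fl_support C p <-> crit_support C p.
Proof.
move=> [[fgC _ _] _ quoC]; split; last exact: crit_fl_support.
move=> [Y [[X CX [f fb]] _ nz]].
apply: (quot_closed_crit quoC (fgC _ CX) CX) => z.
by apply: nz => y; have [g fK gK] := fb; rewrite -[y]gK (z (g y)) linear0.
Qed.

(* Let [M] be the preimage in [Z] of a submodule [V'] of [Z'] critical at [q]. If
   [Z] has no submodule critical at [q], then [V] is essential in [M], as a
   submodule of [M] meeting [V] trivially embeds in [V']. An [r] in [p] but not in
   [q] maps [M] onto a submodule isomorphic to [V'], which meets [V] trivially; an
   [r] in [q] but not in [p] embeds [M] in [V], against maximality. *)
Lemma max_critical p q Z Z' V (j : {linear V -> Z}) (g : {linear Z -> Z'}) :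
  injective j -> critical p V ->
  (forall z, g z = 0 <-> exists v, j v = z) -> (forall z, exists x, g x = z) ->
  (forall W (k : {linear W -> Z}), injective k -> critical p W ->
    (forall v, exists w, k w = j v) -> forall w, exists v, j v = k w) ->
  ass_support Z' q -> ass_support Z q \/ q = p.
Proof.
move=> ji cV gker gs maxV [V' [h [hi cV']]].
case: (pselect (ass_support Z q)) => [|nA]; [by left|right].
have h0 v : h v = 0 -> v = 0 by move=> hv; apply: hi; rewrite linear0.
have j0 v : j v = 0 -> v = 0 by move=> jv; apply: ji; rewrite linear0.
have hM : submod (fun z => exists v, g z = h v).
  split; first by exists 0; rewrite !linear0.
  by move=> a y z [u yu] [v zv]; exists (a *: u + v); rewrite !linearP yu zv.
have [M [i [ii iE]]] := sub_exists hM.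
have [f fE] : exists f : {linear M -> V'}, forall m, h (f m) = (g \o i) m.
  apply: (factor_inj (g := g \o i : {linear M -> Z'})) => // m.
  by have /iE[v gv] : exists m', i m' = i m by [exists m]; exists v.
have i0 m : i m = 0 -> m = 0 by move=> im; apply: ii; rewrite linear0.
have fs v : exists m, f m = v.
  have [z gz] := gs (h v); have /iE[m im] : exists v, g z = h v by exists v.
  by exists m; apply: hi; rewrite fE /= im.
have fker m : f m = 0 <-> exists v, j v = i m.
  split=> [fm|/gker gm]; first by apply/gker; rewrite -[LHS]fE fm linear0.
  by apply: h0; rewrite fE.
have ess (T : M -> Prop) : submod T -> (exists2 m, T m & m <> 0) ->
    exists m, [/\ T m, m <> 0 & f m = 0].
  move=> hT [m Tm m0]; apply: contrapT => no; apply: nA.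
  have [N [k [ki kE]]] := sub_exists hT.
  exists N, (i \o k : {linear N -> Z}); split; first by move=> x y /ii/ki.
  apply: (critical_inj (f := f \o k : {linear N -> V'})) cV'.
    apply: linear_injP => n /= fkn; apply: contrapT => n0; apply: no.
    exists (k n); split=> //; first by apply/kE; exists n.
    by move=> kn; apply: n0; apply: ki; rewrite linear0.
  have /kE[n kn] := Tm; exists n => n0; apply: m0.
  by rewrite -kn n0 linear0.
have [[v' v'0] _ _ _] := cV'; have [m' fm'] := fs v'.
have actl r := @mk_linear L M M (act r).
have actlin r : exists a : {linear M -> M}, forall m, a m = act r m.
  by apply: actl => c x y; rewrite actD (actZ _ c).
have killK (r : R) m : r \in prime_mem p -> f m = 0 -> act r m = 0.
  move=> rp /fker[v jv]; apply: i0; rewrite linear_act -jv -linear_act.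
  by have [_ ann _ _] := cV; rewrite ann // linear0.
have injK (r : R) m : r \notin prime_mem p -> f m = 0 -> act r m = 0 -> m = 0.
  move=> rp /fker[v jv] rm; apply: i0; rewrite -jv.
  case: (pselect (v = 0)) => [->|v0]; first by rewrite linear0.
  case/negP: rp; apply/(critical_act_eq0 r cV v0)/j0.
  by rewrite linear_act jv -linear_act rm linear0.
apply: spec_ext => r; apply/idP/idP => [rq|rp]; apply: contrapT => /negP rn.
  have [a aE] := actlin r.
  have ai : injective a.
    apply: linear_injP => m; rewrite aE => rm; apply: contrapT => m0.
    have [|n [rn0 n0 fn]] := ess (fun m => a m = 0) (submod_preim a (submod_zero M)).
      by exists m; rewrite ?aE.
    by apply: n0; apply: injK rn fn _; rewrite -aE.
  have [b bE] : exists b : {linear M -> V}, forall m, j (b m) = (i \o a) m.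
    apply: (factor_inj (g := i \o a : {linear M -> Z})) => // m /=.
    apply/fker; rewrite aE linear_act.
    by have [_ ann _ _] := cV'; apply: ann.
  have cM : critical p M.
    apply: (critical_inj (f := b)) cV.
      by move=> x y /(congr1 j); rewrite !bE => /ii/ai.
    by exists m' => m0; apply: v'0; rewrite -fm' m0 linear0.
  have [v|v jv] := maxV M i ii cM _ m'.
    by apply/iE; exists 0; rewrite linear0; apply/gker; exists v.
  by apply: v'0; rewrite -fm'; apply/fker; exists v.
have [a aE] := actlin r.
have ra m : act r (f m) = 0 -> f m = 0.
  move=> rf; apply: contrapT => fm; case/negP: rn.
  exact/(critical_act_eq0 r cV' fm).
have [|n [[m _ am] n0 fn]] := ess _ (submod_im a (submod_full M)).
  exists (a m'); first by exists m'.
  by move=> am; apply: v'0; rewrite -fm'; apply: ra; rewrite -linear_act -aE am linear0.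
apply: n0; rewrite -am aE; apply: killK => //; apply: ra.
by rewrite -linear_act -aE am.
Qed.

Hypothesis localL : forall p, morita_local (loc_ring L p).

Lemma critical_embed p V W : fin_gen V -> fin_gen W -> critical p V ->
  critical p W -> exists f : {linear V -> W}, injective f.
Proof.
move=> fV fW cV cW.
have [f fb] := morita_local_simple (localL p) (critical_simple cV) (critical_simple cW).
apply: (lift_injection noethL fV fW _ (bij_inj fb)).
by case: cV.
Qed.

(** [L_p] is nonzero, being Morita equivalent to a local ring, so the regular module has a quotient
    critical at [p]. *)
Lemma critical_at p : exists2 W : lmodType L, fin_gen W & critical p W.
Proof.
have fL : fin_gen (L^o : lmodType L).
  apply/fin_genP; exists [:: 1]; split=> // T hT T1 x _.
  by rewrite -[x]mulr1; apply: (submodZ x hT); apply: T1; rewrite inE.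
have [|W [f [fs cW]]] := critical_quotient (p := p) noethL fL.
  by move=> z; apply: (morita_local_nonzero (localL p)); apply: z.
by exists W => //; apply: (fin_gen_surj fs).
Qed.

(** Closure under submodules calls for an embedding: a simple submodule of [X_p] is isomorphic to
    [W_p] for any [W] critical at [p], and [lift_injection] turns the embedding of [W_p] into one of
    [W] in [X]. *)
Lemma torf_supportP C p : torf C -> fl_support C p <-> crit_support C p.
Proof.
move=> [[fgC _ _] _ subC]; split; last exact: crit_fl_support.
move=> [Y [[X CX /iso_sym[f fb]] flY nz]].
have [N [i [ii sN]]] := fin_length_simple flY nz.
have [W fW cW] := critical_at p.
have [g gb] := morita_local_simple (localL p) (critical_simple cW) sN.
have tW : torsion_free p W by case: cW.
have [|h hi] := @lift_injection _ _ p noethL W X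
    (f \o (i \o g) : {linear loc_mod p W -> loc_mod p X}) fW (fgC _ CX) tW.
  by move=> x y /(bij_inj fb)/ii/(bij_inj gb).
by exists W => //; apply: (subC _ _ h).
Qed.

Lemma torsE C Y : tors C ->
  C Y <-> fin_gen Y /\ forall p, ~ zero_mod (loc_mod p Y) -> fl_support C p.
Proof.
move=> tC; have [[fgC isoC zeroC] extC quoC] := tC; split=> [CY|[fY sY]].
  split=> [|p nz]; first exact: fgC.
  by apply/crit_fl_support/(quot_closed_crit quoC _ CY nz)/fgC.
pose P (N : Y -> Prop) := exists X (i : {linear X -> Y}),
  [/\ C X, injective i & forall y, N y <-> exists x, i x = y].
have [N [hN [X [i [CX ii iE]]] maxN]] : exists N, [/\ submod N, P N &
    forall T, submod T -> P T -> (forall y, N y -> T y) -> forall y, T y -> N y].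
  apply: noeth_max; first exact: (noeth_mod noethL).
  have [X [i [ii iE]]] := sub_exists (submod_zero Y).
  exists (fun y => y = 0); first exact: submod_zero.
  exists X, i; split=> //; apply: zeroC => x.
  by apply: ii; rewrite linear0; apply/iE; exists x.
have [Z [f [fs fker]]] := quot_exists hN.
case: (pselect (zero_mod Z)) => [z|nz].
  apply: (isoC X) CX; exists i; apply: bij_of => // y.
  by apply/iE/fker/z.
have fZ := fin_gen_surj fs fY.
have [p [V [j [ji cV]]]] := critical_exists noethL fZ nz.
have [X' CX' cX'] : crit_support C p.
  apply/tors_supportP => //; apply: sY; apply: (loc_nonzero_surj fs).
  exact: (loc_nonzero_inj ji (critical_loc_nonzero cV)).
(* The module of [C] is embedded in [V], not conversely: [C] is not yet known to be closed under
   submodules. *)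
have [g gi] := critical_embed (fgC _ CX') (fin_gen_inj noethL ji fZ) cX' cV.
have fgE (E : lmodType L) (k : {linear E -> Y}) : injective k -> fin_gen E.
  by move=> ki; apply: (fin_gen_inj noethL ki).
have kerf y : f y = 0 <-> exists x, i x = y by rewrite fker iE.
have jgi : injective (j \o g) by move=> x y /ji/gi.
have [E [k [CE ki kE]]] := ext_closed_preim (h := j \o g : {linear X' -> Z})
  extC fgE ii fs kerf jgi CX CX'.
(* A preimage [y] of the image of a nonzero [x] lies in the larger submodule, hence in [N] by
   maximality, hence is killed by [f]. *)
exfalso; have [[x x0] _ _ _] := cX'; have [y fy] := fs (j (g x)).
have : N y.
  apply: (maxN (fun y => exists e, k e = y)); last by apply/kE; exists x.
  - have := submod_im k (submod_full E); congr submod; apply: funext => w.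
    by apply: propext; split=> [[e _]|[e]]; exists e.
  - by exists E, k.
  - by move=> w /fker fw; apply/kE; exists 0; rewrite !linear0.
move=> /fker; rewrite fy => jg; apply: x0; apply/gi/ji.
by rewrite jg !linear0.
Qed.

Lemma torfE C Y : torf C ->
  C Y <-> fin_gen Y /\ forall p, ass_support Y p -> fl_support C p.
Proof.
move=> tC; have [[fgC isoC zeroC] extC subC] := tC; split=> [CY|[fY sY]].
  split=> [|p [V [i [ii cV]]]]; first exact: fgC.
  apply: crit_fl_support; exists V => //.
  by apply: (subC _ _ i) => //; apply/(fin_gen_inj noethL ii)/fgC.
(* The condition on the quotient is carried along because [ass_support] of a quotient may be larger
   than that of [Y]. *)
pose P (N : Y -> Prop) :=
  (exists X (i : {linear X -> Y}),
    [/\ C X, injective i & forall y, N y <-> exists x, i x = y]) /\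
  exists Z (f : {linear Y -> Z}), [/\ forall z, exists y, f y = z,
    forall y, f y = 0 <-> N y & forall p, ass_support Z p -> fl_support C p].
have [N [hN [[X [i [CX ii iE]]] [Z [f [fs fker sZ]]]] maxN]] :
    exists N, [/\ submod N, P N &
    forall T, submod T -> P T -> (forall y, N y -> T y) -> forall y, T y -> N y].
  apply: noeth_max; first exact: (noeth_mod noethL).
  have [X [i [ii iE]]] := sub_exists (submod_zero Y).
  exists (fun y => y = 0); first exact: submod_zero.
  split; last by exists Y, idfun; split=> // z; exists z.
  exists X, i; split=> //; apply: zeroC => x.
  by apply: ii; rewrite linear0; apply/iE; exists x.
case: (pselect (zero_mod Z)) => [z|nz].
  apply: (isoC X) CX; exists i; apply: bij_of => // y.
  by apply/iE/fker/z.
have fZ := fin_gen_surj fs fY.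
have [p [V0 [j0 [j0i cV0]]]] := critical_exists noethL fZ nz.
have Cp : fl_support C p by apply: sZ; exists V0, j0.
pose P' (K : Z -> Prop) := exists V (j : {linear V -> Z}),
  [/\ injective j, critical p V & forall z, K z <-> exists v, j v = z].
have im_sub V (j : {linear V -> Z}) : submod (fun z => exists v, j v = z).
  split; first by exists 0; rewrite linear0.
  by move=> a _ _ [x <-] [y <-]; exists (a *: x + y); rewrite linearP.
have [K [hK [V [j [ji cV jE]]] maxK]] : exists K, [/\ submod K, P' K &
    forall T, submod T -> P' T -> (forall y, K y -> T y) -> forall y, T y -> K y].
  apply: noeth_max; first exact: (noeth_mod noethL).
  by exists (fun z => exists v, j0 v = z) => //; exists V0, j0.
have CV : C V.
  have [X' CX' cX'] := (torf_supportP p tC).1 Cp.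
  have fV := fin_gen_inj noethL ji fZ.
  (* Here [V] is embedded in a module of [C], so that closure under submodules puts [V] in [C]. *)
  have [g gi] := critical_embed fV (fgC _ CX') cV cX'.
  exact: (subC _ _ g).
have [Z' [g [gs gker]]] := quot_exists hK.
have gjE z : g z = 0 <-> exists v, j v = z by rewrite gker jE.
have fgE (E : lmodType L) (k : {linear E -> Y}) : injective k -> fin_gen E.
  by move=> ki; apply: (fin_gen_inj noethL ki).
have kerf y : f y = 0 <-> exists x, i x = y by rewrite fker iE.
have [E [k [CE ki kE]]] := ext_closed_preim extC fgE ii fs kerf ji CX CV.
exfalso; have [[v v0] _ _ _] := cV; have [y fy] := fs (j v).
have : N y.
  apply: (maxN (fun y => exists v, f y = j v)); last by exists v.
  - split; first by exists 0; rewrite !linear0.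
    by move=> a u w [x ux] [z wz]; exists (a *: x + z); rewrite !linearP ux wz.
  - split; first by exists E, k.
    exists Z', (g \o f : {linear Y -> Z'}); split.
    + by move=> z; have [w <-] := gs z; have [u <-] := fs w; exists u.
    + by move=> u; rewrite /= gjE; split=> -[w]; exists w.
    (* Passing from [Z] to [Z'] adds at most the prime [p], which is already in the support of
       [C]. *)
    + move=> q; case/(max_critical ji cV gjE gs) => [W l li cW jl w|/sZ //|-> //].
      apply/jE; apply: (maxK (fun z => exists w, l w = z)); last by exists w.
      * exact: im_sub.
      * by exists W, l.
      * by move=> z /jE[u <-].
  - by move=> u /fker fu; exists 0; rewrite fu linear0.
move=> /fker; rewrite fy => jv; apply: v0; apply: ji.
by rewrite jv linear0.
Qed.

(** The criterion of [torsE] passes to submodules, since localization preserves injections. *)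
Lemma tors_serre C : tors C -> serre C.
Proof.
move=> tC; have [mC extC quoC] := tC; split=> // X Y f fX fi /(torsE _ tC)[fY sY].
by apply/(torsE _ tC); split=> // p /(loc_nonzero_inj fi)/sY.
Qed.

(** A module critical at [q] has no torsion for denominators outside [p], as these lie outside [q];
    so its localization at [p] is nonzero. *)
Lemma tors_spcl C : tors C -> spcl_closed (fl_support C).
Proof.
move=> tC q p /(tors_supportP _ tC)[X CX cX] qp.
have [[fgC _ _] _ quoC] := tC.
apply/crit_fl_support/(quot_closed_crit quoC (fgC _ CX) CX) => /loc_mod_eq0 z.
have [[x x0] _ tf _] := cX; apply/x0/tf; have [s sx] := z x.
have [|t tE] := @denP_of _ q (den s); last by exists t; rewrite tE.
by apply/negP => /qp; rewrite (negPf (denP s)).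
Qed.

(** * Torsion and torsionfree classes with prescribed support *)

Definition supp_subcat (S : set (spec R)) : subcat L := fun Y =>
  fin_gen Y /\ forall p, ~ zero_mod (loc_mod p Y) -> S p.

Lemma supp_subcat_tors S : tors (supp_subcat S).
Proof.
split; first split.
- by move=> X [].
- move=> X Y [f fb] [fX sX]; have [g gK Kg] := fb.
  have fs y : exists x, f x = y by exists (g y).
  split; first exact: (fin_gen_surj fs).
  by move=> p /(loc_nonzero_surj fs)/sX.
- move=> X z; split=> [|p nz].
    apply/fin_genP; exists [::]; split=> // T hT _ x _.
    by rewrite (z x); apply: submod0.
  case: nz; apply/loc_mod_eq0 => x; exists (den1 p); exact: z.
- move=> X Y Z f g fY [fi gs fg] [_ sX] [_ sZ]; split=> // p nz.
  case: (pselect (zero_mod (loc_mod p X))) => [zX|/sX //].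
  case: (pselect (zero_mod (loc_mod p Z))) => [zZ|/sZ //].
  case: nz; apply/loc_mod_eq0 => y.
  have [s sy] := (loc_mod_eq0 p Z).1 zZ (g y).
  have /fg[x xE] : g (act (den s) y) = 0 by rewrite linear_act.
  have [t tx] := (loc_mod_eq0 p X).1 zX x.
  by exists (denM t s); rewrite denME -actA -xE -linear_act tx linear0.
- move=> X Y f fY fs [fX sX]; split=> // p.
  by move=> /(loc_nonzero_surj fs)/sX.
Qed.

(** A module critical at [p] is killed by [p], so it localizes to zero at [q] unless [q] contains
    [p], and such [q] are in [S]. *)
Lemma supp_subcat_support S : spcl_closed S -> fl_support (supp_subcat S) = S.
Proof.
move=> spS; apply/seteqP; split=> p.
  move=> /(tors_supportP _ (supp_subcat_tors S))[X [_ sX] cX].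
  exact/sX/critical_loc_nonzero.
move=> Sp; apply: crit_fl_support; have [W fW cW] := critical_at p.
exists W => //; split=> // q nz; apply: (spS p) => // r rp.
case: (prime_case q r) => // -[s sE]; case: nz; apply/loc_mod_eq0 => x.
by exists s; rewrite sE; have [_ ann _ _] := cW; apply: ann.
Qed.

Definition ass_subcat (S : set (spec R)) : subcat L := fun Y =>
  fin_gen Y /\ forall p, ass_support Y p -> S p.

Lemma ass_support_inj X Y (f : {linear X -> Y}) p :
  injective f -> ass_support X p -> ass_support Y p.
Proof.
move=> fi [V [i [ii cV]]]; exists V, (f \o i : {linear V -> Y}).
by split=> // x y /fi/ii.
Qed.

Lemma ass_subcat_torf S : torf (ass_subcat S).
Proof.
split; first split.
- by move=> X [].
- move=> X Y [f fb] [fX sX]; have [g gK Kg] := linear_bij_inv fb.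
  split; first by apply: (fin_gen_surj (f := f)) => // y; exists (g y).
  by move=> p /(ass_support_inj (can_inj Kg))/sX.
- move=> X z; split=> [|p [V [i [ii [[v v0] _ _ _]]]]].
    apply/fin_genP; exists [::]; split=> // T hT _ x _.
    by rewrite (z x); apply: submod0.
  by case: v0; apply: ii; rewrite (z (i v)) (z (i 0)).
- move=> X Y Z f g fY [fi gs fg] [_ sX] [_ sZ]; split=> // p [V [i [ii cV]]].
  have hT : submod (fun v => g (i v) = 0).
    exact: (submod_preim (g \o i : {linear V -> Z}) (submod_zero Z)).
  (* Either [V] meets [X], and the intersection is a critical submodule of [X], or [V] embeds in
     [Z]. *)
  case: (pselect (exists2 v, g (i v) = 0 & v <> 0)) => [[v gv v0]|no].
    have [N [k [ki kE]]] := sub_exists hT.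
    have [h hE] : exists h : {linear N -> X}, forall n, f (h n) = (i \o k) n.
      apply: (factor_inj (g := i \o k : {linear N -> Y})) => // n.
      by apply/fg/kE; exists n.
    apply: sX; exists N, h; split.
      by move=> x y /(congr1 f); rewrite !hE => /ii/ki.
    apply: (critical_inj ki) cV; have /kE[n nv] := gv.
    by exists n => n0; apply: v0; rewrite -nv n0 linear0.
  apply: sZ; exists V, (g \o i : {linear V -> Z}); split=> //.
  apply: linear_injP => v gv; apply: contrapT => v0; apply: no.
  by exists v.
- move=> X Y f fX fi [fY sY]; split=> // p.
  by move=> /(ass_support_inj fi)/sY.
Qed.

(** Nonzero submodules of a module critical at [p] are critical at [p] and at no other prime, so one
    such module realizes [p] alone. *)
Lemma ass_subcat_support S : fl_support (ass_subcat S) = S.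
Proof.
apply/seteqP; split=> p.
  move=> /(torf_supportP _ (ass_subcat_torf S))[X [_ sX] cX].
  by apply: sX; exists X, idfun; split=> // x y.
move=> Sp; apply: crit_fl_support; have [W fW cW] := critical_at p.
exists W => //; split=> // q [V [i [ii cV]]].
suff -> : q = p by [].
apply: (critical_prime cV); apply: (critical_inj ii) cW.
by case: cV.
Qed.

End Classification.

Lemma subcat_ext (A : pzRingType) (C D : subcat A) :
  (forall X, C X <-> D X) -> C = D.
Proof.
by move=> h; apply: functional_extensionality_dep => X; apply: propext.
Qed.

Theorem corollary1p3 (R : comPzRingType) (L : ralgebra R)
    (noethL : noetherian_algebra L)
    (localL : forall p : spec R, morita_local (loc_ring L p)) :
  (@tors L = @serre L /\
   poset_iso (@subcat_le L) (@subset (spec R))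
     (@tors L) (@spcl_closed R) (@fl_support R L)) /\
  poset_iso (@subcat_le L) (@subset (spec R))
    (@torf L) [set: set (spec R)]%classic (@fl_support R L).
Proof.
have mono C D : subcat_le C D -> subset (@fl_support R L C) (@fl_support R L D).
  by move=> CD p [Y [[X CX XY] flY nz]]; exists Y; split=> //; exists X => //; apply: CD.
split; first split.
- apply: functional_extensionality_dep => C; apply: propext.
  by split=> [/(tors_serre noethL localL)|[? ? ? ?]].
(* By [torsE] the support determines the class, so inclusions of supports are reflected. *)
- have le C D : tors C -> tors D ->
      subcat_le C D <-> subset (@fl_support R L C) (@fl_support R L D).
    move=> tC tD; split=> [/mono //|CD X].
    move=> /(torsE noethL localL _ tC)[fX sX]; apply/(torsE noethL localL _ tD).
    by split=> // p /sX/CD.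
  split=> //.
  + exact: tors_spcl.
  + move=> C D tC tD E; apply: subcat_ext => X.
    by split; [apply: (le C D tC tD).2|apply: (le D C tD tC).2]; rewrite E.
  + move=> S spS; exists (supp_subcat S); first exact: supp_subcat_tors.
    exact: supp_subcat_support.
(* The same with [torfE]. *)
have le C D : torf C -> torf D ->
    subcat_le C D <-> subset (@fl_support R L C) (@fl_support R L D).
  move=> tC tD; split=> [/mono //|CD X].
  move=> /(torfE noethL localL _ tC)[fX sX]; apply/(torfE noethL localL _ tD).
  by split=> // p /sX/CD.
split=> //.
- move=> C D tC tD E; apply: subcat_ext => X.
  by split; [apply: (le C D tC tD).2|apply: (le D C tD tC).2]; rewrite E.
- move=> S _; exists (ass_subcat S); first exact: ass_subcat_torf.
  exact: ass_subcat_support.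
Qed.
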